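(* Let $U$ be uniformly distributed on $[0,1]$, and for positive real $n$ let $Z_n=\Vert(U,1-U)\Vert_n=\big(U^n+(1-U)^n\big)^{1/n}$. As $n\to\infty$, $Z_n$ converges in distribution, and with convergence of all integer moments, \[ Z_n=\big(U^n+(1-U)^n\big)^{\frac1n}\to Z_\infty=\max\{U,1-U\}. \] (a) For every positive integer $s\ge 1$, \[ \mathbb{E}(Z_n^s)=\frac{2\left(1-\frac{1}{2^{s+1}}\right)}{s+1}+\sum_{p=2}^\infty\frac{(-1)^p}{n^p}\sum_{k=1}^{p-1}\frac{s^{k}}{s+1}\sum_{j=1}^{s+1}\gamma_{s+1,j}(-1)^{j-1} E_{p-k+j-1}(0)\,\zeta(\overline{p+1-k},\{1\}_{k-1}), \] where the values $\gamma_{s+1,j}$ are given by $\gamma_{s+1,j}=\frac{(-1)^{j-1}}{s!}\genfrac{[}{]}{0pt}{}{s+1}{j}=(-1)^{j-1}\zeta_s(\{1\}_{j-1})$. (b) For arbitrary positive real $s>0$, \[ \mathbb{E}(Z_n^s)=\frac{2\left(1-\frac{1}{2^{s+1}}\right)}{s+1}+\sum_{p=2}^\infty \frac{(-1)^p}{n^p}\sum_{k=1}^{p-1}\frac{s^k}{s+1}\,\zeta(\overline{p+1-k},\{1\}_{k-1})\sum_{\ell=1}^{p-k}(s+1)^{\underline{\ell}}\,B_{p-k,\ell}(E_1(0),\dots,E_{p-k-\ell+1}(0)). \]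
   Context: The series in powers of $1/n$ are meant as asymptotic expansions as $n\to\infty$. $\{1\}_m$ denotes $1$ repeated $m$ times. The alternating multiple zeta value is $\zeta(\bar j,\{1\}_{m})=\sum_{n_1>n_2>\cdots>n_{m+1}\ge 1}\frac{(-1)^{n_1}}{n_1^{j}\,n_2\cdots n_{m+1}}$. The truncated multiple zeta value is $\zeta_r(\{1\}_k)=\sum_{r\ge n_1>\cdots>n_k\ge1}\frac{1}{n_1\cdots n_k}$, with $\zeta_r(\{1\}_0)=1$. $\genfrac{[}{]}{0pt}{}{m}{j}$ are the signless Stirling numbers of the first kind. $E_n(x)$ are the Euler polynomials, $\frac{2e^{tx}}{1+e^t}=\sum_{j\ge0}E_j(x)\frac{t^j}{j!}$. $x^{\underline{\ell}}=x(x-1)\cdots(x-\ell+1)$ is the falling factorial. The Bell polynomials are \[ B_{n,k}(x_1,\dots,x_{n-k+1})=\sum\frac{n!}{j_1!\cdots j_{n-k+1}!}\left(\frac{x_1}{1!}\right)^{j_1}\cdots\left(\frac{x_{n-k+1}}{(n-k+1)!}\right)^{j_{n-k+1}}, \] the sum being over nonnegative integers $j_1,\dots,j_{n-k+1}$ with $\sum_\ell j_\ell=k$ and $\sum_\ell \ell j_\ell=n$.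
   Formalization: In (b) the factor s^k/(s+1) is replaced by s^k/(2^s(s+1)): as printed, (b) is false for every s>0, since the true 1/n^2 coefficient is s 2^{-s} pi^2/24 and not s pi^2/24 (at s=1 it also contradicts (a), which gives pi^2/48). *)

(* Defs.v *)
From HB Require Import structures.
From mathcomp Require Import all_boot all_order all_algebra.
From mathcomp Require Import all_classical all_reals all_analysis.
From mathcomp Require Import measurable_realfun.

Set Implicit Arguments.
Unset Strict Implicit.
Unset Printing Implicit Defensive.

Import Order.TTheory GRing.Theory Num.Theory.
Import numFieldNormedType.Exports.

Local Open Scope classical_set_scope.
Local Open Scope ring_scope.

(* An index i : 'I_r stands for the summation variable i.+1, which ranges
   over 1, ..., r; the tuple t lists n_1 > n_2 > ... > n_k. *)

Definition strictly_decreasing (r k : nat) (t : k.-tuple 'I_r) : bool :=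
  sorted (fun i j : 'I_r => (j < i)%N) t.

(* zeta_r({1}_k) *)
Definition mzv_trunc (R : realType) (r k : nat) : R :=
  \sum_(t : k.-tuple 'I_r | strictly_decreasing t) \prod_(i <- t) (i.+1%:R)^-1.

(* The part n_1 <= r of the series zeta(\bar j, {1}_m). *)
Definition altmzv_trunc (R : realType) (j m r : nat) : R :=
  \sum_(t : m.+1.-tuple 'I_r | strictly_decreasing t)
    (-1) ^+ (thead t).+1 / (thead t).+1%:R ^+ j *
    \prod_(i <- behead t) (i.+1%:R)^-1.

(* zeta(\bar j, {1}_m) *)
Definition altmzv (R : realType) (j m : nat) : R :=
  limn (fun r => altmzv_trunc R j m r).

Fixpoint stirling1 (m j : nat) : nat :=
  match m, j with
  | 0, 0 => 1
  | 0, _.+1 => 0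
  | _.+1, 0 => 0
  | m'.+1, j'.+1 => m' * stirling1 m' j'.+1 + stirling1 m' j'
  end.

(* gamma_{s+1,j} *)
Definition gamma_coef (R : realType) (s j : nat) : R :=
  (-1) ^+ (j - 1) / s`!%:R * (stirling1 s.+1 j)%:R.

(* E_n(x), as n! times the Taylor coefficient of order n at t = 0 of the
   generating function 2 e^{tx} / (1 + e^t). *)
Definition euler_poly (R : realType) (n : nat) (x : R) : R :=
  derive1n n (fun t : R => 2 * expR (t * x) / (1 + expR t)) 0.

Definition falling (R : realType) (x : R) (l : nat) : R :=
  \prod_(i < l) (x - i%:R).

(* Partial Bell polynomial B_{n,k}(x_1, ..., x_{n-k+1}), for k <= n.  The
   exponent j_l is [j i] with l = i.+1; bounding it by k is harmless since the
   exponents sum to k. *)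
Definition bell (R : realType) (n k : nat) (x : nat -> R) : R :=
  \sum_(j : {ffun 'I_(n - k).+1 -> 'I_k.+1} |
        (\sum_(i < (n - k).+1) j i == k)%N &&
        (\sum_(i < (n - k).+1) i.+1 * j i == n)%N)
    n`!%:R / (\prod_(i < (n - k).+1) (j i)`!%:R) *
    \prod_(i < (n - k).+1) (x i.+1 / (i.+1)`!%:R) ^+ (j i).

(* f(n) ~ sum_{p >= m} a_p / n^p as n -> +oo over the reals, in the sense of
   Poincare: the remainder after the term of order N is o(n^{-N}). *)
Definition asymptotic_expansion (R : realType) (m : nat)
    (f : R -> R) (a : nat -> R) : Prop :=
  forall N : nat,
    n ^+ N * (f n - \sum_(m <= p < N.+1) a p / n ^+ p) @[n --> +oo] --> (0 : R).

Definition cvg_in_distribution (R : realType) (d : measure_display)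
    (T : measurableType d) (P : probability T R) (I : Type)
    (F : set_system I) (X : I -> {RV P >-> R}) (Y : {RV P >-> R}) : Prop :=
  forall x : R, {for x, continuous (cdf Y)} ->
    cdf (X i) x @[i --> F] --> cdf Y x.

Section norms.
Context (R : realType) (d : measure_display) (T : measurableType d)
  (P : probability T R) (U : {RV P >-> R}).

Definition Z (n : R) (w : T) : R :=
  (U w `^ n + (1 - U w) `^ n) `^ n^-1.

Definition Zoo (w : T) : R := Num.max (U w) (1 - U w).

Lemma measurable_Z (n : R) : measurable_fun [set: T] (Z n).
Proof.
have mU : measurable_fun [set: T] (fun w => 1 - U w) by exact: measurable_funB.
apply: (measurableT_comp (f := fun x : R => x `^ n^-1)) => //.
apply: measurable_funD.
- exact: (measurableT_comp (f := fun x : R => x `^ n)).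
- exact: (measurableT_comp (f := fun x : R => x `^ n)).
Qed.

Lemma measurable_Zoo : measurable_fun [set: T] Zoo.
Proof. by apply: measurable_maxr => //; exact: measurable_funB. Qed.

HB.instance Definition _ (n : R) :=
  isMeasurableFun.Build _ _ T R (Z n) (measurable_Z n).

HB.instance Definition _ :=
  isMeasurableFun.Build _ _ T R Zoo measurable_Zoo.

Definition Z_RV (n : R) : {RV P >-> R} := Z n.
Definition Zoo_RV : {RV P >-> R} := Zoo.

End norms.

(* Main.v *)
Require Import Defs.
From HB Require Import structures.
From mathcomp Require Import all_boot all_order all_algebra.
From mathcomp Require Import all_classical all_reals all_analysis.
From mathcomp Require Import measurable_realfun.
From mathcomp Require Import ring lra.
Import Order.TTheory GRing.Theory Num.Theory.
Import numFieldNormedType.Exports.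
Local Open Scope classical_set_scope.
Local Open Scope ring_scope.

Set Implicit Arguments.
Unset Strict Implicit.
Unset Printing Implicit Defensive.

(** Write w = max(U, 1 - U), uniform on [1/2, 1], and r = 1 / w - 1, so that
    Z_n ^ s = w ^ s (1 + r ^ n) ^ e with e = s / n and
    E(Z_n ^ s) = 2 int_{1/2}^1 w ^ s (1 + r ^ n) ^ e dw
    (fine_expectation_pnorm).  The two convergence statements follow from
    Z_oo <= Z_n <= 2 ^ (1/n) Z_oo (max_le_pnorm, pnorm_le_max).

    The binomial series in r ^ n turns the integral into a sum over N >= 1 of
    C(e, N) times the moment int w ^ s r ^ (nN) dw, and each of the two factors
    has an expansion with an explicit error.

    - C(e, N) = (-1) ^ (N-1) (e / N) prod_{i < N} (1 - e / i), and expanding the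
      product in powers of e produces the truncated zeta values
      zeta_{N-1}({1}_k); the error is bounded by the first omitted term
      (bonferroni).

    - The moment int w ^ s r ^ a dw has an expansion in powers of 1 / a
      obtained by integrating by parts (powmoment_expansion).  Since
      w = 1 / (1 + exp t) when r = exp t, its coefficients are, up to signs
      and a constant factor, the derivatives at 0 of F ^ (s + 1), where
      F(t) = 2 / (1 + exp t) is the generating function of the numbers E_j(0).

    Multiplying the expansions and summing over N gives the alternating values
    zeta(bar(m+1), {1}_k).  All the errors are sums over N of
    zeta_{N-1}({1}_k) / N ^ 2, which are at most 2 whatever k is
    (sum_mzv_sqr), so the expansion is uniform in N and can be summed termwise
    (half_moment_expansion).

    It remains to express the derivatives of F ^ a at 0 in two ways.  As
    F' = F (F / 2 - 1), differentiation acts on polynomials in F as the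
    derivation logder of R[X], and everything becomes algebra at X = 1.  For
    arbitrary a, expanding F ^ a in powers of F - 1 gives the Bell polynomials
    (twcoef_bell).  For a = s + 1 a positive integer, F ^ (s + 1) is a linear
    combination of derivatives of F whose coefficients are Stirling numbers
    (twcoef_stirling1). *)

(** * Recurrences for truncated multiple zeta values *)

Section mzv.
Context (R : realType).

Let weight (r k : nat) (t : k.-tuple 'I_r) : R := \prod_(i <- t) (i.+1%:R)^-1.

(** A tuple over 'I_r with entries below N is the same as a tuple over 'I_N;
    keeping r fixed avoids casts between ordinal types when the largest entry
    of a tuple is split off. *)
Let below (r k N : nat) : R :=
  \sum_(t : k.-tuple 'I_r |
        strictly_decreasing t && all (fun i : 'I_r => (i < N)%N) t) weight t.

Lemma strictly_decreasing_cons (r k : nat) (x : 'I_r) (t : k.-tuple 'I_r) :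
  strictly_decreasing [tuple of x :: t] =
  strictly_decreasing t && all (fun i : 'I_r => (i < x)%N) t.
Proof.
rewrite /strictly_decreasing /= path_sortedE 1?andbC//.
by move=> i j k' /= ji ik; exact: ltn_trans ik ji.
Qed.

Lemma below_cons (r m N : nat) (f : nat -> R) :
  \sum_(t : m.+1.-tuple 'I_r |
        strictly_decreasing t && all (fun i : 'I_r => (i < N)%N) t)
    f (thead t) * \prod_(i <- behead t) (i.+1%:R)^-1 =
  \sum_(x < r | (x < N)%N) f x * below r m x.
Proof.
rewrite (reindex (fun p : 'I_r * m.-tuple 'I_r => [tuple of p.1 :: p.2]))/=; last first.
  exists (fun t : m.+1.-tuple 'I_r => (thead t, behead_tuple t)).
    by case=> x t _ /=; rewrite theadE; congr pair; exact: val_inj.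
  by move=> t _ /=; rewrite [RHS]tuple_eta; apply: val_inj.
rewrite /below; under [RHS]eq_bigr do rewrite big_distrr/=.
rewrite pair_big_dep/=; apply: eq_big => [[x t]|[x t] _] /=.
  rewrite strictly_decreasing_cons /=.
  have [xN|]//= := ltnP x N; last by rewrite !andbF.
  rewrite -andbA; congr (_ && _); apply/idP/idP => [/andP[]//|h].
  rewrite h/=; apply: sub_all h => i ix; exact: ltn_trans ix xN.
by rewrite theadE.
Qed.

Lemma below_indep (k r N : nat) : (N <= r)%N -> below r k N = mzv_trunc R N k.
Proof.
have E q : mzv_trunc R q k = below q k q.
  apply: eq_bigl => t; rewrite [X in _ && X](_ : _ = true) ?andbT//.
  by apply/allP => i _; exact: ltn_ord.
rewrite E {E}; elim: k r N => [|k IH] r N Nr.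
  by rewrite /below !(big_pred1 [tuple])/weight ?big_nil//= => t;
    rewrite (tuple0 t); exact/esym/eqxx.
have S q M : (M <= q)%N ->
    below q k.+1 M = \sum_(x < M) (x.+1%:R)^-1 * below x k x.
  move=> Mq; rewrite (big_ord_widen _ (fun x => (x.+1%:R)^-1 * below x k x) Mq).
  transitivity (\sum_(x < q | (x < M)%N) (x.+1%:R)^-1 * below q k x).
    rewrite -(below_cons _ _ _ (fun x => (x.+1%:R)^-1)); apply: eq_bigr => t _.
    by rewrite /weight [in LHS](tuple_eta t) /= big_cons.
  by apply: eq_bigr => x _; rewrite (IH q) // ltnW.
by rewrite !S.
Qed.

(** Sums over decreasing tuples are computed by splitting off the largest
    entry: what remains ranges over the tuples that lie below it. *)
Lemma sum_strictly_decreasing (r m : nat) (f : nat -> R) :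
  \sum_(t : m.+1.-tuple 'I_r | strictly_decreasing t)
    f (thead t) * \prod_(i <- behead t) (i.+1%:R)^-1 =
  \sum_(N < r) f N * mzv_trunc R N m.
Proof.
transitivity (\sum_(x < r | (x < r)%N) f x * below r m x).
  rewrite -below_cons; apply: eq_bigl => t.
  rewrite [X in _ && X](_ : _ = true) ?andbT//.
  by apply/allP => i _; exact: ltn_ord.
by apply: eq_big => [x|x _]; [exact: ltn_ord|rewrite below_indep// ltnW].
Qed.

Lemma mzv_trunc0 (r : nat) : mzv_trunc R r 0 = 1.
Proof.
rewrite /mzv_trunc (big_pred1 [tuple]) ?big_nil//= => t.
by rewrite (tuple0 t); exact/esym/eqxx.
Qed.

Lemma mzv_truncE (r k : nat) :
  mzv_trunc R r k.+1 = \sum_(N < r) (N.+1%:R)^-1 * mzv_trunc R N k.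
Proof.
rewrite -(sum_strictly_decreasing _ _ (fun N => (N.+1%:R)^-1)).
by apply: eq_bigr => t _; rewrite [in LHS](tuple_eta t) /= big_cons.
Qed.

Lemma mzv_trunc0S (k : nat) : mzv_trunc R 0 k.+1 = 0.
Proof. by rewrite mzv_truncE big_ord0. Qed.

Lemma mzv_truncS (r k : nat) :
  mzv_trunc R r.+1 k.+1 = mzv_trunc R r k.+1 + mzv_trunc R r k / r.+1%:R.
Proof. by rewrite !mzv_truncE big_ord_recr/= [_^-1 * _]mulrC. Qed.

Lemma mzv_trunc_ge0 (r k : nat) : 0 <= mzv_trunc R r k.
Proof.
by apply: sumr_ge0 => t _; apply: prodr_ge0 => i _; rewrite invr_ge0.
Qed.

Lemma altmzv_truncE (j m r : nat) :
  altmzv_trunc R j m r =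
  \sum_(N < r) (-1) ^+ N.+1 / N.+1%:R ^+ j * mzv_trunc R N m.
Proof.
by rewrite -(sum_strictly_decreasing _ _ (fun N => (-1) ^+ N.+1 / N.+1%:R ^+ j)).
Qed.

(** Both sides satisfy the same recurrence, that of the coefficients of
    (x + 1) ... (x + s). *)
Lemma stirling1_mzv (s j : nat) :
  (stirling1 s.+1 j.+1)%:R = s`!%:R * mzv_trunc R s j.
Proof.
elim: s j => [|s IH] [|j].
- by rewrite mzv_trunc0 mulr1.
- by rewrite mzv_trunc0S mulr0.
- (* Folds the recursive call that simplification has unfolded. *)
  rewrite mzv_trunc0 [stirling1 _ _]/= -[(_ * _ + _)%N]/((s.+1 * stirling1 s.+1 1 + 0)%N).
  by rewrite addn0 natrM IH mzv_trunc0 factS natrM; ring.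
- rewrite -[stirling1 _ _]/((s.+1 * stirling1 s.+1 j.+2 + stirling1 s.+1 j.+1)%N).
  rewrite natrD natrM !IH mzv_truncS factS natrM.
  by field; rewrite nat1r pnatr_eq0.
Qed.

Lemma gamma_coefE (s j : nat) : (1 <= j)%N ->
  gamma_coef R s j = (-1) ^+ (j - 1) * mzv_trunc R s (j - 1).
Proof.
case: j => // j _; rewrite /gamma_coef stirling1_mzv subn1/=.
by field; rewrite pnatr_eq0 -lt0n fact_gt0.
Qed.

End mzv.

(** * Binomial coefficients with a small real upper index *)

(* Discharges the side conditions of field on casts of successors. *)
Ltac nz := rewrite ?nat1r -?natrD ?pnatr_eq0 //=.

Section binomial_coefficients.
Context (R : realType).
Implicit Types (a e : R).

Definition gbin a (N : nat) : R := falling a N / N`!%:R.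

Lemma gbin0 a : gbin a 0 = 1.
Proof. by rewrite /gbin /falling big_ord0 divr1. Qed.

Lemma gbinS a (N : nat) : N.+1%:R * gbin a N.+1 = (a - N%:R) * gbin a N.
Proof.
rewrite /gbin /falling big_ord_recr/= factS natrM.
by field; nz; rewrite -lt0n fact_gt0.
Qed.

(** The generating polynomial of the mzv_trunc R r k, evaluated at - e. *)
Definition altprod e (r : nat) : R := \prod_(i < r) (1 - e / i.+1%:R).

Lemma altprod_itv01 e (r : nat) : 0 <= e <= 1 -> 0 <= altprod e r <= 1.
Proof.
move=> /andP[e0 e1]; apply/andP.
have h (i : nat) : 0 <= e / i.+1%:R <= 1.
  rewrite divr_ge0//= ler_pdivrMr// mul1r (le_trans e1)// -[leLHS]/(1%:R).
  by rewrite ler_nat.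
split; first by apply: prodr_ge0 => i _; rewrite subr_ge0; case/andP: (h i).
apply: prodr_ile1 => i _; have /andP[? ?] := h i.
by rewrite subr_ge0 lerBlDr lerDl; apply/andP.
Qed.

Lemma gbin_altprod e (N : nat) :
  gbin e N.+1 = (-1) ^+ N * (e / N.+1%:R) * altprod e N.
Proof.
elim: N => [|N IH].
  rewrite /altprod big_ord0 expr0 mul1r mulr1 divr1.
  by have := gbinS e 0; rewrite gbin0 subr0 mul1r mulr1.
have := gbinS e N.+1; rewrite IH => E.
have -> : gbin e N.+2 =
   (e - N.+1%:R) * ((-1) ^+ N * (e / N.+1%:R) * altprod e N) / N.+2%:R.
  by rewrite -E mulrC mulrA mulVf ?mul1r// pnatr_eq0.
rewrite /altprod big_ord_recr/= exprS.
by field; nz.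
Qed.

(** For 0 <= e <= 1 the product of the 1 - e / i lies in [0, 1]. *)
Lemma norm_gbin e (N : nat) : 0 <= e <= 1 -> `|gbin e N.+1| <= e / N.+1%:R.
Proof.
move=> e01; have /andP[a0 a1] := altprod_itv01 N e01; have /andP[e0 _] := e01.
rewrite gbin_altprod !normrM normrX normrN1 expr1n mul1r.
rewrite (ger0_norm a0) (ger0_norm e0) ger0_norm ?invr_ge0//.
by rewrite ler_piMr// divr_ge0.
Qed.

(** The alternating partial sums of the expansion of a product of factors in
    [0, 1] lie alternately above and below it: peeling off one factor
    expresses the signed remainder as a combination of two earlier remainders
    with nonnegative coefficients. *)
Let bonferroni_ge0 e (r K : nat) : 0 <= e <= 1 ->
  0 <= (-1) ^+ K * (altprod e r - \sum_(k < K) (- e) ^+ k * mzv_trunc R r k).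
Proof.
move=> e01; elim: r K => [|r IH] [|K].
- by rewrite big_ord0 subr0 expr0 mul1r; case/andP: (altprod_itv01 0 e01).
- rewrite /altprod big_ord0 big_ord_recl/= mzv_trunc0 big1 ?subrr ?addr0 ?mulr1 ?subrr ?mulr0//.
  by move=> i _; rewrite mzv_trunc0S mulr0.
- by rewrite big_ord0 subr0 expr0 mul1r; case/andP: (altprod_itv01 r.+1 e01).
- have := IH K; have := IH K.+1.
  have -> : altprod e r.+1 = altprod e r * (1 - e / r.+1%:R).
    by rewrite /altprod big_ord_recr.
  have -> : \sum_(k < K.+1) (- e) ^+ k * mzv_trunc R r.+1 k =
     \sum_(k < K.+1) (- e) ^+ k * mzv_trunc R r k -
      e / r.+1%:R * \sum_(k < K) (- e) ^+ k * mzv_trunc R r k.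
    rewrite !big_ord_recl/= !mzv_trunc0 -addrA; congr (_ + _).
    rewrite big_distrr/= -sumrN -big_split/=; apply: eq_bigr => i _.
    by rewrite mzv_truncS /bump/= add1n exprS; field; nz.
  set A := \sum_(k < K.+1) _; set B := \sum_(k < K) _.
  rewrite exprS => h1 h2.
  have -> : -1 * (-1) ^+ K *
      (altprod e r * (1 - e / r.+1%:R) - (A - e / r.+1%:R * B)) =
      -1 * (-1) ^+ K * (altprod e r - A) +
      e / r.+1%:R * ((-1) ^+ K * (altprod e r - B)) by ring.
  by rewrite addr_ge0// mulr_ge0// divr_ge0//; case/andP: e01.
Qed.

(** The remainders of orders K and K + 1 have opposite signs and differ by the
    term of order K, which therefore bounds both. *)
Lemma bonferroni e (r K : nat) : 0 <= e <= 1 ->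
  `|altprod e r - \sum_(k < K) (- e) ^+ k * mzv_trunc R r k|
  <= e ^+ K * mzv_trunc R r K.
Proof.
move=> e01; have := bonferroni_ge0 r K e01; have := bonferroni_ge0 r K.+1 e01.
rewrite big_ord_recr/= exprS [(- e) ^+ K]exprNn.
set B := \sum_(k < K) _; set c := (-1) ^+ K => h1 h2.
have cc : c * c = 1 by rewrite /c -exprMn mulrNN mulr1 expr1n.
have -> : altprod e r - B = c * (c * (altprod e r - B)) by rewrite mulrA cc mul1r.
rewrite normrM /c normrX normrN1 expr1n mul1r -/c ger0_norm// -subr_ge0.
rewrite -[e ^+ K]mul1r -cc; apply: le_trans h1 _.
by rewrite le_eqVlt; apply/orP; left; apply/eqP; ring.
Qed.

(** Abel summation, since 1 / ((N+1) (N+2)) is the decrement of 1 / (N+1) and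
    mzv_trunc R N k / (N+1) is the increment of mzv_trunc R N k.+1. *)
Lemma sum_mzv_abel (M k : nat) :
  \sum_(N < M) mzv_trunc R N k.+1 / (N.+1%:R * N.+2%:R) +
    mzv_trunc R M k.+1 / M.+1%:R =
  \sum_(N < M) mzv_trunc R N k / (N.+1%:R * N.+2%:R).
Proof.
elim: M => [|M IH]; first by rewrite !big_ord0 mzv_trunc0S mul0r addr0.
rewrite !big_ord_recr/= -IH mzv_truncS.
by field; nz.
Qed.

(** By sum_mzv_abel these sums decrease with k, so no growth estimate on the
    truncated zeta values is needed: the case k = 0 telescopes. *)
Lemma sum_mzv_le1 (M k : nat) :
  \sum_(N < M) mzv_trunc R N k / (N.+1%:R * N.+2%:R) <= 1.
Proof.
elim: k => [|k IH]; last first.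
  by apply: le_trans IH; rewrite -(sum_mzv_abel M k) lerDl divr_ge0// mzv_trunc_ge0.
have -> : \sum_(N < M) mzv_trunc R N 0 / (N.+1%:R * N.+2%:R) = 1 - M.+1%:R^-1.
  elim: M => [|M IH]; first by rewrite big_ord0 invr1 subrr.
  by rewrite big_ord_recr/= IH mzv_trunc0; field; nz.
by rewrite lerBlDr lerDl invr_ge0.
Qed.

Lemma sum_mzv_sqr (M k : nat) :
  \sum_(N < M) mzv_trunc R N k / N.+1%:R ^+ 2 <= 2.
Proof.
apply: (@le_trans _ _ (2 * \sum_(N < M) mzv_trunc R N k / (N.+1%:R * N.+2%:R))).
  rewrite big_distrr/=; apply: ler_sum => N _.
  rewrite expr2 mulrCA ler_wpM2l ?mzv_trunc_ge0// !invfM mulrCA.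
  rewrite ler_wpM2l ?invr_ge0// ler_pdivlMr// mulrC ler_pdivrMr//.
  by rewrite -natrM ler_nat mul2n -addnn addSn ltnS addnS ltnS leq_addr.
by rewrite ler_piMr// sum_mzv_le1.
Qed.

Lemma altmzv_cvg (j m : nat) : (2 <= j)%N ->
  altmzv_trunc R j m r @[r --> \oo] --> altmzv R j m.
Proof.
move=> j2.
pose u (N : nat) : R := (-1) ^+ N.+1 / N.+1%:R ^+ j * mzv_trunc R N m.
have E : (fun r => altmzv_trunc R j m r) = series u.
  by apply/funext => r; rewrite altmzv_truncE /series/= big_mkord.
rewrite /altmzv E; apply: normed_cvg.
have -> : [normed series u] = (fun r => \sum_(N < r) `|u N|).
  by apply/funext => r; rewrite /normed_series_of /series/= big_mkord.
apply: nondecreasing_is_cvgn.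
  by apply/nondecreasing_seqP => n; rewrite big_ord_recr/= lerDl normr_ge0.
exists 2 => _ [M _ <-].
apply: le_trans (sum_mzv_sqr M m); apply: ler_sum => N _.
rewrite /u !normrM normrX normrN1 expr1n mul1r mulrC.
rewrite (ger0_norm (mzv_trunc_ge0 _ _ _)) ler_wpM2l ?mzv_trunc_ge0//.
rewrite ger0_norm ?invr_ge0 ?exprn_ge0// lef_pV2 ?posrE ?exprn_gt0//.
by rewrite ler_weXn2l// -[leLHS]/(1%:R) ler_nat.
Qed.

End binomial_coefficients.

(** * Remainder of the binomial series *)

Section binomial_series.
Context (R : realType).

Lemma is_derive_ler (f df : R -> R) (a b : R) : a <= b ->
  (forall x, x \in `[a, b] -> is_derive x 1 f (df x)) ->
  (forall x, x \in `[a, b] -> 0 <= df x) -> f a <= f b.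
Proof.
move=> ab fdf df0.
have fo x : x \in `]a, b[ -> is_derive x 1 f (df x).
  by move=> /subset_itv_oo_cc; exact: fdf.
have fc : {within `[a, b], continuous f}.
  by apply: derivable_within_continuous => x xab; have [] := fdf _ xab.
have [c cab] := MVT_segment ab fo fc.
move=> /eqP; rewrite subr_eq => /eqP ->.
by rewrite lerDr mulr_ge0 ?df0// subr_ge0.
Qed.

Definition binpoly (a : R) (M : nat) : {poly R} := \sum_(N < M.+1) gbin a N *: 'X^N.

Lemma binpolyS (a : R) (M : nat) :
  binpoly a M.+1 = binpoly a M + gbin a M.+1 *: 'X^(M.+1).
Proof. by rewrite /binpoly big_ord_recr. Qed.

(** Truncating the binomial series leaves a single monomial as the defect in
    the differential equation (1 + X) T' = a T of its sum: the coefficients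
    cancel in pairs by gbinS. *)
Lemma binpoly_ode (a : R) (M : nat) :
  (1 + 'X) * (binpoly a M)^`() =
  a *: binpoly a M - (M.+1%:R * gbin a M.+1) *: 'X^M.
Proof.
elim: M => [|M IH].
  rewrite /binpoly big_ord_recl big_ord0 addr0 expr0 derivZ -polyC1 derivC.
  by rewrite scaler0 mulr0 gbinS subr0 gbin0 scale1r mulr1 subrr.
rewrite binpolyS derivD derivZ derivXn mulrDr IH [in RHS]gbinS.
rewrite -!mul_polyC -mulr_natl exprS !rmorphM/= rmorphB/= !polyC_natr.
by ring.
Qed.

(** By binpoly_ode, T (1 + y) ^ (- a) has derivative
    - (M+1) C(a, M+1) y ^ M (1 + y) ^ (- a - 1), which is dominated by the
    derivative of |C(a, M+1)| y ^ (M+1).  The bound is uniform up to y = 1,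
    where the series is not geometrically convergent; the factor 2 bounds
    (1 + y) ^ a. *)
Lemma binomial_remainder (a y : R) (M : nat) : 0 <= a <= 1 -> 0 <= y <= 1 ->
  `|(1 + y) `^ a - \sum_(N < M.+1) gbin a N * y ^+ N| <= 2 * `|gbin a M.+1|.
Proof.
move=> /andP[a0 a1] /andP[y0 y1].
set T := binpoly a M; set g := gbin a M.+1.
have TE : \sum_(N < M.+1) gbin a N * y ^+ N = T.[y].
  rewrite /T/binpoly horner_sum; apply: eq_bigr => i _.
  by rewrite hornerZ hornerXn.
rewrite TE.
pose phi x := T.[x] * (1 + x) `^ (- a).
have dphi x : x \in `[0, y] -> is_derive x 1 phi
    (- (M.+1%:R * g * x ^+ M * (1 + x) `^ (- a - 1))).
  rewrite in_itv/= => /andP[x0 xy].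
  have x1 : 0 < 1 + x by rewrite ltr_pwDl.
  have d1 : is_derive x 1 (fun x => 1 + x) 1.
    by apply: (is_derive_eq (is_deriveD (is_derive_cst (1 : R) x 1) (is_derive_id x 1))); rewrite add0r.
  have d2 := is_derive1_comp (is_derive1_powR (- a) x1) d1.
  apply: (is_derive_eq (is_deriveM (is_derive_poly T x) d2)).
  rewrite mulr1 /=.
  have -> : (1 + x) `^ (- a) = (1 + x) * (1 + x) `^ (- a - 1).
    by rewrite powRB ?(gt_eqF x1) ?implybT// powRr1 ?(ltW x1)// mulrC divfK ?(gt_eqF x1).
  have := congr1 (horner^~ x) (binpoly_ode a M).
  rewrite /= !hornerE /= -/T -/g => E.
  rewrite /GRing.scale/=.
  transitivity (((1 + x) * T^`().[x] - a * T.[x]) * (1 + x) `^ (- a - 1)); first ring.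
  by rewrite E; ring.
have phi0 : phi 0 = 1.
  rewrite /phi addr0 powR1 mulr1 /T /binpoly horner_sum big_ord_recl/=.
  rewrite hornerZ hornerXn expr0 gbin0 big1 ?addr0 ?mulr1// => i _.
  by rewrite hornerZ hornerXn /= expr0n mulr0.
(* With c = 1 and c = -1 this bounds phi y - 1 from both sides. *)
have key c : c = 1 \/ c = -1 -> 0 <= c * (phi y - 1) + `|g| * y ^+ M.+1.
  move=> c1.
  pose psi := fun x => c * phi x + `|g| * ('X^(M.+1) : {poly R}).[x].
  suff : psi 0 <= psi y.
    by rewrite /psi phi0 !hornerXn expr0n mulr0 addr0 => h; lra.
  apply: (@is_derive_ler _ (fun x => c * (- (M.+1%:R * g * x ^+ M * (1 + x) `^ (- a - 1)))
      + `|g| * (M.+1%:R * x ^+ M)) _ _ y0) => x xy.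
    apply: (is_derive_eq (is_deriveD (is_deriveZ c (dphi _ xy))
      (is_deriveZ `|g| (is_derive_poly 'X^(M.+1) x)))).
    by rewrite derivXn hornerMn hornerXn /GRing.scale/= [X in _ = _ + _ * X]mulr_natl.
  have /andP[x0 _] : 0 <= x <= y by move: xy; rewrite in_itv.
  have p1 : (1 + x) `^ (- a - 1) <= 1.
    by rewrite -opprD powRN invf_le1 ?powR_gt0 ?ltr_pwDl// -[leLHS](powRr0 (1 + x)) ler_powR// ?lerDl// addr_ge0.
  have p0 := powR_ge0 (1 + x) (- a - 1).
  have -> : c * - (M.+1%:R * g * x ^+ M * (1 + x) `^ (- a - 1)) + `|g| * (M.+1%:R * x ^+ M)
     = (M.+1%:R * x ^+ M) * (`|g| - c * g * (1 + x) `^ (- a - 1)) by ring.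
  rewrite mulr_ge0 ?mulr_ge0 ?exprn_ge0// subr_ge0.
  apply: (le_trans (ler_norm _)); rewrite normrM [X in _ * X <= _]ger0_norm//.
  have -> : `|c * g| = `|g| by case: c1 => ->; rewrite ?mul1r ?mulN1r ?normrN.
  by rewrite ler_piMr.
have phiy : `|phi y - 1| <= `|g|.
  have yM : `|g| * y ^+ M.+1 <= `|g| by rewrite ler_piMr// exprn_ile1.
  have h1 := key 1 (or_introl erefl); have h2 := key (-1) (or_intror erefl).
  by rewrite ler_norml; lra.
have y1' : 0 < 1 + y by rewrite ltr_pwDl.
have -> : (1 + y) `^ a - T.[y] = - ((phi y - 1) * (1 + y) `^ a).
  by rewrite mulrBl mul1r /phi powRN -mulrA mulVf ?mulr1 ?opprB// gt_eqF// powR_gt0.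
rewrite normrN normrM mulrC ler_pM//.
rewrite ger0_norm ?powR_ge0//.
apply: le_trans (ler1_powR _ a1) _; first by rewrite lerDl.
by rewrite -[leRHS]/(1 + 1) lerD2l.
Qed.

End binomial_series.

(** * The derivation of the logistic function *)

Section logistic_derivation.
Context (R : realType).
Implicit Types (P Q : {poly R}) (a : R).

(** Differentiation in t of a polynomial in F(t) = 2 / (1 + exp t), since
    F' = F ^ 2 / 2 - F. *)
Definition logder Q : {poly R} := Q^`() * (2^-1 *: 'X^2 - 'X).

(** The conjugate of logder by X ^ a: (F ^ a Q(F))' = F ^ a (twlogder a Q)(F).
    It makes sense for every real a without leaving R[X]. *)
Definition twlogder a Q : {poly R} := logder Q + (a *: (2^-1 *: 'X - 1)) * Q.

(** F 0 = 1, so the derivatives of F at 0 are values at X = 1. *)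
Definition eulerp (n : nat) : R := (iter n logder 'X).[1].

(** The derivative of order n of F ^ a at 0. *)
Definition twcoef a (n : nat) : R := (iter n (twlogder a) 1).[1].

Let F (t : R) : R := 2 / (1 + expR t).

Lemma is_derive_horner_F Q (t : R) :
  is_derive t 1 (fun t => Q.[F t]) (logder Q).[F t].
Proof.
have e1 : 1 + expR t != 0 by rewrite gt_eqF// addr_gt0// expR_gt0.
have d1 : is_derive t 1 (fun x => 1 + expR x) (expR t).
  by apply: (is_derive_eq (is_deriveD (is_derive_cst (1 : R) t 1) (is_derive_expR t)));
    rewrite add0r.
have dF : is_derive t 1 F (- (2 * expR t / (1 + expR t) ^+ 2)).
  apply: (is_derive_eq (is_deriveZ (2 : R) (@is_deriveV R (fun x => 1 + expR x) t _ 1 e1 d1))).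
  rewrite /GRing.scale/=; field.
  by move: e1.
apply: (is_derive_eq (is_derive1_comp (is_derive_poly Q (F t)) dF)).
rewrite /logder hornerM hornerD hornerN hornerZ hornerXn hornerX /F; congr (_ * _); field.
by move: e1.
Qed.

Lemma euler_poly0 (n : nat) : euler_poly n (0 : R) = eulerp n.
Proof.
rewrite /euler_poly.
have -> : (fun t : R => 2 * expR (t * 0) / (1 + expR t)) = F.
  by apply/funext => t; rewrite mulr0 expR0 mulr1.
have H : derive1n n F = (fun t => (iter n logder 'X).[F t]).
  elim: n => [|n IH]; first by apply/funext => t; rewrite /= hornerX.
  apply/funext => t; rewrite derive1nS IH derive1E.
  by have := is_derive_horner_F (iter n logder 'X) t => /@derive_val.
by rewrite H /eulerp /F expR0 -[1 + 1]/(2 : R) divff.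
Qed.

Lemma logderD P Q : logder (P + Q) = logder P + logder Q.
Proof. by rewrite /logder derivD mulrDl. Qed.

Lemma logderZ a Q : logder (a *: Q) = a *: logder Q.
Proof. by rewrite /logder derivZ -scalerAl. Qed.

Lemma logderM P Q : logder (P * Q) = logder P * Q + P * logder Q.
Proof. by rewrite /logder derivM; ring. Qed.

Lemma logder1 : logder 1 = 0.
Proof. by rewrite /logder -polyC1 derivC mul0r. Qed.

Lemma logder_sum (I : Type) (r : seq I) (D : I -> {poly R}) :
  logder (\sum_(i <- r) D i) = \sum_(i <- r) logder (D i).
Proof.
by apply: (big_morph logder logderD); rewrite /logder deriv0 mul0r.
Qed.

Lemma iter_logder_sum (n : nat) (I : Type) (r : seq I) (D : I -> {poly R}) :
  iter n logder (\sum_(i <- r) D i) = \sum_(i <- r) iter n logder (D i).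
Proof. by elim: n => //= n ->; rewrite logder_sum. Qed.

Lemma iter_logderZ (n : nat) a Q : iter n logder (a *: Q) = a *: iter n logder Q.
Proof. by elim: n => //= n ->; rewrite logderZ. Qed.

Let dlog (n : nat) Q := n`!%:R^-1 *: iter n logder Q.

Let dlogS (n : nat) Q : logder (dlog n Q) = n.+1%:R *: dlog n.+1 Q.
Proof.
rewrite /dlog logderZ scalerA factS natrM /=; congr (_ *: _).
by field; nz; rewrite -lt0n fact_gt0.
Qed.

(** Leibniz rule in divided form, which has no binomial coefficients. *)
Let dlogM (n : nat) P Q : dlog n (P * Q) = \sum_(i < n.+1) dlog i P * dlog (n - i) Q.
Proof.
elim: n => [|n IH].
  by rewrite big_ord_recl big_ord0 addr0 /dlog /= !fact0 invr1 !scale1r.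
apply: (@scalerI _ _ n.+1%:R); first by rewrite pnatr_eq0.
rewrite -dlogS IH logder_sum.
under eq_bigr => i _ do rewrite logderM !dlogS.
rewrite big_split/=.
have -> : \sum_(i < n.+1) (i.+1%:R *: dlog i.+1 P) * dlog (n - i) Q =
    \sum_(i < n.+2) i%:R *: (dlog i P * dlog (n.+1 - i) Q).
  rewrite [RHS]big_ord_recl/= scale0r add0r; apply: eq_bigr => i _.
  by rewrite /bump/= add1n subSS scalerAl.
have -> : \sum_(i < n.+1) dlog i P * ((n - i).+1%:R *: dlog (n - i).+1 Q) =
    \sum_(i < n.+2) (n.+1 - i)%:R *: (dlog i P * dlog (n.+1 - i) Q).
  rewrite [RHS]big_ord_recr/= subnn scale0r addr0; apply: eq_bigr => i _.
  by rewrite -subSn// ?scalerAr// -ltnS.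
rewrite -big_split/= scaler_sumr; apply: eq_bigr => i _.
by rewrite -scalerDl -natrD subnKC// -ltnS.
Qed.

(** The Taylor coefficient of order n at t = 0 of Q(F(t)). *)
Definition taylor1 (n : nat) Q : R := (iter n logder Q).[1] / n`!%:R.

Lemma taylor1M (n : nat) P Q :
  taylor1 n (P * Q) = \sum_(i < n.+1) taylor1 i P * taylor1 (n - i) Q.
Proof.
have E m (G : {poly R}) : taylor1 m G = (dlog m G).[1].
  by rewrite /dlog hornerZ mulrC.
rewrite E dlogM horner_sum; apply: eq_bigr => i _.
by rewrite hornerM !E.
Qed.

Lemma taylor1X (n i l : nat) Q : (i <= n)%N ->
  taylor1 i (Q ^+ l) = ((\poly_(j < n.+1) taylor1 j Q) ^+ l)`_i.
Proof.
elim: l i => [|l IH] i ilen.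
  rewrite !expr0 coef1 /taylor1; case: i ilen => [|i] _ /=.
    by rewrite fact0 divr1 hornerE.
  rewrite (_ : logder _ = 0) ?horner0 ?mul0r//.
  by elim: i => [|i IH]; rewrite /= ?logder1// IH /logder deriv0 mul0r.
rewrite !exprS taylor1M coefM; apply: eq_bigr => j _.
have jn : (j <= n)%N by rewrite (leq_trans _ ilen)// -ltnS.
by rewrite coef_poly ltnS jn IH// (leq_trans (leq_subr _ _)).
Qed.

Lemma taylor1_subX1 (n : nat) :
  taylor1 n ('X - 1) = if n is 0 then 0 else eulerp n / n`!%:R.
Proof.
case: n => [|n]; first by rewrite /taylor1 /= !hornerE subrr mul0r.
rewrite /taylor1 /eulerp !iterSr; congr (_.[_] / _); congr (iter _ _ _).
by rewrite /logder derivB -polyC1 derivC subr0.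
Qed.

(** F ^ a may be replaced by its truncated binomial series in w = X - 1.  The
    truncation S satisfies logder S = a (X / 2 - 1) S up to a multiple of
    w ^ n, hence logder ^ k S = S * twlogder ^ k 1 up to a multiple of
    w ^ (n + 1 - k), as each derivation lowers the order at w = 0 by at most
    one.  For k = n the error still vanishes at X = 1, where S = 1. *)
Lemma twcoef_taylor1 a (n : nat) :
  twcoef a n = \sum_(l < n.+1) gbin a l * (n`!%:R * taylor1 n (('X - 1) ^+ l)).
Proof.
set w : {poly R} := 'X - 1.
have dw1 : w^`() = 1 by rewrite /w derivB derivX -polyC1 derivC subr0.
pose S := \sum_(l < n.+1) gbin a l *: w ^+ l.
have Sder m : 'X * (\sum_(l < m.+1) gbin a l *: w ^+ l)^`() =
    a *: (\sum_(l < m.+1) gbin a l *: w ^+ l) - (m.+1%:R * gbin a m.+1) *: w ^+ m.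
  elim: m => [|m IH].
    rewrite big_ord_recl big_ord0 addr0 expr0 derivZ -polyC1 derivC.
    by rewrite scaler0 mulr0 gbinS subr0 gbin0 scale1r mulr1 subrr.
  rewrite big_ord_recr derivD derivZ deriv_exp dw1 mul1r mulrDr IH [in RHS]gbinS/=.
  rewrite -!mul_polyC -mulr_natl !exprS !rmorphM/= rmorphB/= !polyC_natr.
  have -> : 'X = w + 1 by rewrite /w subrK.
  by ring.
have dS : logder S = (a *: (2^-1 *: 'X - 1)) * S -
    w ^+ n * ((n.+1%:R * gbin a n.+1) *: (2^-1 *: 'X - 1)).
  rewrite /logder.
  have -> : 2^-1 *: 'X^2 - 'X = 'X * (2^-1 *: 'X - 1) :> {poly R}.
    by rewrite -!mul_polyC; ring.
  rewrite mulrA [_^`() * _]mulrC Sder -/S -!mul_polyC; ring.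
have H k : (k <= n)%N ->
    exists W, iter k logder S = S * iter k (twlogder a) 1 + w ^+ (n.+1 - k) * W.
  elim: k => [_|k IH kn]; first by exists 0; rewrite /= mulr1 mulr0 addr0.
  have [W E] := IH (ltnW kn).
  have [m nk] : exists m, (n - k)%N = m.+1 by exists (n - k).-1; rewrite prednK// subn_gt0.
  have dw : exists V, logder (w ^+ m.+2 * W) = w ^+ m.+1 * V.
    exists (m.+2%:R * (2^-1 *: 'X^2 - 'X) * W + w * logder W).
    rewrite logderM {1}/logder deriv_exp dw1 mul1r -mulr_natl /= [w ^+ m.+2]exprS.
    by ring.
  have [V EV] := dw.
  exists (V - w ^+ (n - m.+1) * ((n.+1%:R * gbin a n.+1) *: (2^-1 *: 'X - 1)) * iter k (twlogder a) 1).
  rewrite !iterS E logderD (logderM S) dS subSS nk subSn ?(ltnW kn)// nk EV /twlogder.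
  have -> : w ^+ n = w ^+ m.+1 * w ^+ (n - m.+1).
    by rewrite -exprD subnKC// -nk leq_subr.
  by ring.
have [W EW] := H n (leqnn n).
have S1 : S.[1] = 1.
  rewrite /S horner_sum big_ord_recl/= big1 ?addr0 ?hornerE ?gbin0//= => i _.
  by rewrite !hornerE subrr expr0n mulr0.
have -> : twcoef a n = (iter n logder S).[1].
  by rewrite EW subSnn !hornerE/= S1 subrr !mul1r mul0r addr0.
rewrite iter_logder_sum horner_sum; apply: eq_bigr => i _.
rewrite iter_logderZ hornerZ /taylor1; congr (_ * _).
by rewrite mulrC divfK// pnatr_eq0 -lt0n fact_gt0.
Qed.

Lemma twcoef_nat (s m : nat) : twcoef s%:R m = (iter m logder 'X^s).[1].
Proof.
have -> : iter m logder 'X^s = 'X^s * iter m (twlogder s%:R) 1.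
  elim: m => [|m IH]; first by rewrite /= mulr1.
  rewrite /= IH logderM /twlogder mulrDr addrC; congr (_ + _).
  rewrite /logder derivXn -mulr_natl -!mul_polyC polyC_natr.
  case: s {IH} => [|s] /=; first by ring.
  by rewrite ['X^(s.+1)]exprS; ring.
by rewrite hornerM hornerXn expr1n mul1r.
Qed.

Lemma stirling1_gt (s j : nat) : (s < j)%N -> stirling1 s j = 0%N.
Proof.
elim: s j => [|s IH] [|j]//= sj; rewrite !IH ?muln0//.
by rewrite (ltn_trans _ sj).
Qed.

(** In the ring generated by the logistic function, multiplication by X acts
    on X ^ (s + 1) as 2 (1 + logder / (s + 1)); expanding the product of these
    operators is what brings in the Stirling numbers. *)
Lemma stirling1_logder (s : nat) :
  (s`!%:R / 2 ^+ s) *: 'X^(s.+1) =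
  \sum_(j < s.+1) (stirling1 s.+1 j.+1)%:R *: iter j logder 'X :> {poly R}.
Proof.
elim: s => [|s IH].
  by rewrite big_ord_recl big_ord0 addr0 fact0 expr0 divr1 /= !scale1r.
pose L Q : {poly R} := s.+1%:R *: Q + logder Q.
transitivity (L ((s`!%:R / 2 ^+ s) *: 'X^(s.+1))).
  rewrite /L /logder derivZ derivXn /= -!mul_polyC !factS natrM -mulr_natl !exprS.
  rewrite invfM !rmorphM/= !polyC_natr.
  by ring.
rewrite IH /L logder_sum scaler_sumr.
under [X in _ + X = _]eq_bigr do rewrite logderZ.
have -> : \sum_(i < s.+1) s.+1%:R *: ((stirling1 s.+1 i.+1)%:R *: iter i logder 'X) =
  \sum_(i < s.+2) (s.+1 * stirling1 s.+1 i.+1)%:R *: iter i logder 'X :> {poly R}.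
  rewrite [RHS]big_ord_recr/= [X in _ + X](_ : _ = 0) ?addr0.
    by apply: eq_bigr => i _; rewrite scalerA -natrM.
  by rewrite -/(stirling1 s.+1 s.+2) stirling1_gt// muln0 scale0r.
have -> : \sum_(i < s.+1) (stirling1 s.+1 i.+1)%:R *: logder (iter i logder 'X) =
  \sum_(i < s.+2) (stirling1 s.+1 i)%:R *: iter i logder 'X :> {poly R}.
  by rewrite [RHS]big_ord_recl/= scale0r add0r; apply: eq_bigr.
rewrite -big_split/=; apply: eq_bigr => i _.
by rewrite -scalerDl -natrD.
Qed.

Lemma twcoef_stirling1 (s m : nat) :
  twcoef s.+1%:R m / 2 ^+ s =
  \sum_(j < s.+1) (stirling1 s.+1 j.+1)%:R / s`!%:R * eulerp (m + j).
Proof.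
have f0 : s`!%:R != 0 :> R by rewrite pnatr_eq0 -lt0n fact_gt0.
have := congr1 (fun Q => (iter m logder Q).[1]) (stirling1_logder s).
rewrite /= iter_logderZ hornerZ iter_logder_sum horner_sum -twcoef_nat => E.
have -> : twcoef s.+1%:R m / 2 ^+ s = (s`!%:R)^-1 * (s`!%:R / 2 ^+ s * twcoef s.+1%:R m).
  by field; rewrite f0 expf_neq0.
rewrite E big_distrr/=; apply: eq_bigr => j _.
by rewrite iter_logderZ hornerZ /eulerp iterD mulrA [_^-1 * _]mulrC.
Qed.

End logistic_derivation.

(** * Bell polynomials *)

Section bell_polynomials.
Context (R : realType).

(** Multinomial theorem, read off the coefficient of t ^ l in the product of
    the truncated exponential series of the summands.  The morphism f provides
    the inverse factorials in A. *)
Lemma multinomial (A : comNzRingType) (f : {rmorphism R -> A}) (M l : nat)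
    (y : 'I_M -> A) :
  f (l`!%:R^-1) * (\sum_(i < M) y i) ^+ l =
  \sum_(j : {ffun 'I_M -> 'I_l.+1} | (\sum_(i < M) j i == l)%N)
    \prod_(i < M) (f ((j i)`!%:R^-1) * y i ^+ j i).
Proof.
pose E (z : A) : {poly A} := \poly_(j < l.+1) (f (j`!%:R^-1) * z ^+ j).
have fE (k : nat) : k`!%:R != 0 :> R by rewrite pnatr_eq0 -lt0n fact_gt0.
have H k : (k <= l)%N -> (\prod_(i < M) E (y i))`_k =
    f (k`!%:R^-1) * (\sum_(i < M) y i) ^+ k.
  elim: M y k => [|M IH] y k kl.
    rewrite !big_ord0 coef1 expr0n; case: k {kl} => [|k] /=; last by rewrite mulr0.
    by rewrite fact0 invr1 mulr1 (rmorph1 f).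
  rewrite !big_ord_recl coefM exprDn big_distrr/=.
  rewrite (reindex_inj rev_ord_inj)/=; apply: eq_bigr => i _.
  have ik : (i <= k)%N by rewrite -ltnS.
  rewrite subSS subKn// IH ?(leq_trans ik)// coef_poly ltnS.
  rewrite (leq_trans (leq_subr _ _) kl) mulrACA -rmorphM.
  rewrite -[X in _ = _ * X]mulr_natl [RHS]mulrA -[in RHS](rmorph_nat f) -[in RHS]rmorphM.
  congr (f _ * _).
  rewrite -[in RHS](bin_fact ik) !natrM; field.
  by rewrite !fE pnatr_eq0 -lt0n bin_gt0.
rewrite -H//.
have -> : \prod_(i < M) E (y i) =
    \prod_(i < M) \sum_(j < l.+1) (f (j`!%:R^-1) * y i ^+ j) *: 'X^j.
  by apply: eq_bigr => i _; rewrite /E poly_def.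
rewrite bigA_distr_bigA coef_sum/= [RHS]big_mkcond/=; apply: eq_bigr => j _.
rewrite scaler_prod -expr_sum coefZ coefXn eq_sym.
by case: eqP => _; rewrite ?mulr1 ?mulr0.
Qed.

Lemma coefX_congr (p q : {poly R}) (m l : nat) :
  (forall i, (i <= m)%N -> p`_i = q`_i) ->
  forall i, (i <= m)%N -> (p ^+ l)`_i = (q ^+ l)`_i.
Proof.
move=> pq; elim: l => [|l IH] i im; first by rewrite !expr0.
rewrite !exprS !coefM; apply: eq_bigr => j _.
have ji : (j <= i)%N by rewrite -ltnS.
by rewrite pq ?IH ?(leq_trans (leq_subr _ _))// (leq_trans ji).
Qed.

(** Partial Bell polynomials are the Taylor coefficients of the powers of the
    exponential generating function of x, here without constant term.  In a
    power l of such a series only the terms of order at most n - l + 1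
    contribute to the coefficient of order n. *)
Lemma bell_coef (n l : nat) (x : nat -> R) : (l <= n)%N ->
  l`!%:R * bell n l x =
  n`!%:R * ((\poly_(i < n.+1) if i is 0 then 0 else x i / i`!%:R) ^+ l)`_n.
Proof.
move=> ln; set p := \poly_(i < n.+1) _.
pose y (i : nat) : R := x i.+1 / i.+1`!%:R.
set M := (n - l).+1.
have pE : p = 'X * \poly_(i < n) y i.
  apply/polyP => -[|i]; first by rewrite coef_poly coefXM.
  by rewrite coefXM !coef_poly ltnS.
have -> : (p ^+ l)`_n = (('X * \poly_(i < M) y i) ^+ l)`_n.
  case: l ln @M => [|l] ln M; first by rewrite !expr0.
  rewrite pE !exprMn !coefXnM ltnNge ln/=.
  apply: (@coefX_congr _ _ (n - l.+1)) => // i iln; rewrite !coef_poly /M ltnS iln.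
  by rewrite (leq_ltn_trans iln)// -subSn// subSS leq_subr.
have -> : 'X * \poly_(i < M) y i = \sum_(i < M) (y i)%:P * 'X^(i.+1).
  rewrite poly_def big_distrr/=; apply: eq_bigr => i _.
  by rewrite -mul_polyC mulrCA exprS.
have f0 : l`!%:R != 0 :> R by rewrite pnatr_eq0 -lt0n fact_gt0.
set q := \sum_(i < M) _.
have -> : q ^+ l = (l`!%:R)%:P * ((l`!%:R^-1)%:P * q ^+ l).
  by rewrite mulrA -polyCM mulfV// mul1r.
rewrite coefCM [RHS]mulrCA; congr (_ * _).
rewrite (@multinomial _ (@polyC R)) coef_sum big_distrr/= /bell -/M big_mkcondr/=.
apply: eq_bigr => j _.
have -> : \prod_(i < M) ((j i)`!%:R^-1%:P * ((y i)%:P * 'X^(i.+1)) ^+ j i) =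
   (\prod_(i < M) ((j i)`!%:R^-1 * (y i) ^+ j i))%:P * 'X^(\sum_(i < M) i.+1 * j i).
  rewrite rmorph_prod/= expr_sum -big_split/=; apply: eq_bigr => i _.
  by rewrite exprMn -exprM [X in _ = X * _]polyCM polyC_exp mulrA.
rewrite coefCM coefXn eq_sym; case: eqP => _; last by rewrite !mulr0.
by rewrite mulr1 big_split/= prodfV mulrA.
Qed.

(** Euler numbers E_i(0) enter as the Taylor coefficients of F - 1. *)
Lemma twcoef_bell (a : R) (n : nat) : (0 < n)%N ->
  twcoef a n = \sum_(1 <= l < n.+1)
    falling a l * bell n l (fun i => euler_poly i 0).
Proof.
move=> n0; rewrite twcoef_taylor1 -(big_mkord xpredT
  (fun l => gbin a l * (n`!%:R * taylor1 n (('X - 1) ^+ l)))) big_ltn//.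
rewrite (_ : taylor1 n _ = 0) ?mulr0 ?add0r; last first.
  by rewrite (@taylor1X _ n)// expr0 coef1; case: n n0.
apply: eq_big_nat => l /andP[_ ln]; rewrite ltnS in ln.
rewrite (@taylor1X _ n)//.
have -> : \poly_(j < n.+1) taylor1 j ('X - 1) =
    \poly_(i < n.+1) (if i is 0 then 0 else euler_poly i 0 / i`!%:R) :> {poly R}.
  apply/polyP => i; rewrite !coef_poly taylor1_subX1.
  by case: i => // i; rewrite euler_poly0.
rewrite -(@bell_coef n l (fun i => euler_poly i 0))// /gbin mulrA divfK//.
Qed.

End bell_polynomials.

(** * Moments of the ratio 1 / w - 1 on [1/2, 1] *)

Section half_interval.
Context (R : realType).
Notation mu := (@lebesgue_measure R).
Notation I := (`[2^-1, 1]%classic : set R).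

Lemma in_half (w : R) : I w -> 2^-1 <= w /\ w <= 1.
Proof. by rewrite /= in_itv/= => /andP[]. Qed.

Lemma half_itv_gt0 (w : R) : I w -> 0 < w.
Proof. by move=> /in_half[h _]; apply: lt_le_trans h; rewrite invr_gt0. Qed.

Lemma Rintegral_FTC2 (f F : R -> R) (a b : R) : a < b ->
  (forall x, x \in `[a, b] -> {for x, continuous f}) ->
  (forall x, x \in `[a, b] -> {for x, continuous F}) ->
  (forall x, x \in `]a, b[ -> is_derive x 1 F (f x)) ->
  \int[mu]_(x in `[a, b]%classic) f x = F b - F a.
Proof.
move=> ab cf cF dF; rewrite /Rintegral (@continuous_FTC2 _ f F)//.
- by apply: continuous_in_subspaceT => x /set_mem; exact: cf.
- split; first by move=> x xab; have [] := dF x xab.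
  + by apply: cvg_at_right_filter; apply: cF; rewrite in_itv/= lexx ltW.
  + by apply: cvg_at_left_filter; apply: cF; rewrite in_itv/= lexx ltW.
- by move=> x xab; rewrite derive1E; have [_ ->] := dF x xab.
Qed.

Lemma half_integrable (f : R -> R) :
  (forall x, I x -> {for x, continuous f}) -> mu.-integrable I (EFin \o f).
Proof.
move=> cf; apply: continuous_compact_integrable; first exact: segment_compact.
by apply: continuous_in_subspaceT => x /set_mem; exact: cf.
Qed.

Lemma half_integral_bound (f : R -> R) (C : R) : 0 <= C ->
  (forall x, I x -> {for x, continuous f}) ->
  (forall x, I x -> `|f x| <= C) -> `|\int[mu]_(x in I) f x| <= C.
Proof.
move=> C0 cf fC.
apply: le_trans (le_normr_Rintegral _ (half_integrable cf)) _ => //.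
have cC (x : R) : I x -> {for x, continuous (fun=> C)} by move=> _; exact: cvg_cst.
apply: (@le_trans _ _ (\int[mu]_(x in I) C)).
  apply: le_Rintegral => //; last exact: half_integrable.
  apply: half_integrable => x Ix; apply: continuous_comp; first exact: cf.
  exact: norm_continuous.
have muI : mu I = (1 - 2^-1)%:E.
  by rewrite lebesgue_measure_itv/= lte_fin invf_lt1 ?ltr1n.
have mu1 : fine (mu I) <= 1 by rewrite muI/= lerBlDr lerDl invr_ge0.
by rewrite Rintegral_cst//; exact: ler_piMr C0 mu1.
Qed.

Lemma continuous_norm_powR (a x : R) : 0 < a ->
  {for x, continuous (fun y : R => `|y| `^ a)}.
Proof.
move=> a0; have [->|x0] := eqVneq x 0; last first.
  apply: (@continuous_comp _ _ _ (fun y : R => `|y|) (fun y => y `^ a)).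
    exact: norm_continuous.
  apply: differentiable_continuous; apply/derivable1_diffP.
  by apply: derivable_powR; rewrite in_itv/= andbT normr_gt0.
rewrite /prop_for/continuous_at normr0 powR0 ?gt_eqF//.
apply/cvgr0Pnorm_lt => e e0; near=> y.
rewrite ger0_norm ?powR_ge0//.
have -> : e = (e `^ a^-1) `^ a by rewrite -powRrM mulVf ?gt_eqF// powRr1 ?ltW.
rewrite gt0_ltr_powR ?nnegrE ?powR_ge0//.
near: y; apply/nbhs_ballP; exists (e `^ a^-1) => /=; first by rewrite powR_gt0.
by move=> z; rewrite /ball/= sub0r normrN.
Unshelve. all: by end_near. Qed.

(** The absolute value keeps this function continuous at w = 1, where the
    ratio 1 / w - 1 changes sign. *)
Definition ratiopow (a w : R) : R := `|w^-1 - 1| `^ a.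

Lemma continuous_ratiopow (a w : R) : 0 < a -> w != 0 ->
  {for w, continuous (ratiopow a)}.
Proof.
move=> a0 w0.
apply: (@continuous_comp _ _ _ (fun w : R => w^-1 - 1) (fun y => `|y| `^ a)).
  apply: cvgB; last exact: cvg_cst.
  by apply: (@cvgV _ _ _ _ id) => //; exact: cvg_id.
exact: continuous_norm_powR.
Qed.

Lemma ratio_itv (w : R) : I w -> 0 <= w^-1 - 1 <= 1.
Proof.
move=> Iw; have w0 := half_itv_gt0 Iw; have [w1 w2] := in_half Iw.
rewrite subr_ge0 lerBlDr -[1 + 1]/(2 : R).
by rewrite invf_ge1// w2 -[leRHS]invrK lef_pV2 ?posrE ?invr_gt0.
Qed.

Lemma ratiopow_itv (a w : R) : 0 < a -> I w -> 0 <= ratiopow a w <= 1.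
Proof.
move=> a0 /ratio_itv /andP[r0 r1]; rewrite powR_ge0/=.
apply: (@le_trans _ _ (1 `^ a)); last by rewrite powR1.
by rewrite ge0_ler_powR ?nnegrE ?(ltW a0)// ger0_norm.
Qed.

Lemma is_derive_ratiopow (a w : R) : 0 < w < 1 ->
  is_derive w 1 (ratiopow a)
    (- (a * (w^-1 - 1) `^ (a - 1) * w^-2)).
Proof.
move=> /andP[w0 w1].
have r0 : 0 < w^-1 - 1 by rewrite subr_gt0 invf_gt1.
have wn0 : id w != 0 by rewrite gt_eqF.
apply: (@near_eq_is_derive R R R (fun w : R => (w^-1 - 1) `^ a) (ratiopow a)).
  near=> z; rewrite /ratiopow ger0_norm// subr_ge0 invf_ge1.
    by apply/ltW; near: z; exact: lt_nbhsl.
  by near: z; exact: lt_nbhsr.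
have dr : is_derive w 1 (fun w : R => w^-1 - 1) (- w^-2).
  apply: (is_derive_eq (is_deriveB (@is_deriveV _ id w 1 1 wn0 (is_derive_id _ _))
    (is_derive_cst (1 : R) w 1))).
  by rewrite subr0 /GRing.scale/= mulr1.
apply: (is_derive_eq (@is_derive1_comp R (fun y : R => y `^ a) (fun w : R => w^-1 - 1) w _ _
  (is_derive1_powR a r0) dr)).
by rewrite mulrN.
Unshelve. all: by end_near. Qed.

Section laplace.
Variable s : R.
Hypothesis s0 : 0 < s.

(** With w = F(t) / 2, the function Phi m is the derivative of order m in t of
    w ^ (s + 1), while dPhi m is the derivative of Phi m in w. *)
Let Q (m : nat) : {poly R} := iter m (twlogder (s + 1)) 1.
Let Phi (m : nat) (w : R) : R := w `^ (s + 1) * (Q m).[2 * w].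
Let dPhi (m : nat) (w : R) : R :=
  (s + 1) * w `^ s * (Q m).[2 * w] + w `^ (s + 1) * (2 * (Q m)^`().[2 * w]).

Let powS (w : R) : 0 < w -> w `^ (s + 1) = w `^ s * w.
Proof.
by move=> w0; rewrite powRD ?powRr1 ?(ltW w0)// (gt_eqF w0) implybT.
Qed.

Let is_derive_Phi (m : nat) (w : R) : 0 < w -> is_derive w 1 (Phi m) (dPhi m w).
Proof.
move=> w0.
have d2 : is_derive w 1 (fun w : R => 2 * w) 2.
  by apply: (is_derive_eq (is_deriveZ (2 : R) (is_derive_id w 1))); rewrite /GRing.scale/= mulr1.
apply: (is_derive_eq (is_deriveM (is_derive1_powR (s + 1) w0)
  (is_derive1_comp (is_derive_poly (Q m) (2 * w)) d2))).
by rewrite /dPhi /GRing.scale/= addrK; ring.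
Qed.

Let continuous_derive (f : R -> R) (x df : R) : is_derive x 1 f df ->
  {for x, continuous f}.
Proof.
by move=> [df' _]; apply: differentiable_continuous; exact/derivable1_diffP.
Qed.

Let continuous_dPhi (m : nat) (w : R) : 0 < w -> {for w, continuous (dPhi m)}.
Proof.
move=> w0.
have ch (p : {poly R}) : {for w, continuous (fun w : R => p.[2 * w])}.
  apply: (@continuous_comp _ _ _ (fun w : R => 2 * w)); last exact: continuous_horner.
  by apply: cvgM; [exact: cvg_cst|exact: cvg_id].
have cp a : {for w, continuous (fun w : R => w `^ a)}.
  exact: continuous_derive (is_derive1_powR a w0).
apply: cvgD.
- apply: cvgM; last exact: ch.
  by apply: cvgM; [exact: cvg_cst|exact: cp].
- apply: cvgM; first exact: cp.
  by apply: cvgM; [exact: cvg_cst|exact: ch].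
Qed.

(** dw / dt = w (w - 1). *)
Let PhiS (m : nat) (w : R) : 0 < w -> w * (w - 1) * dPhi m w = Phi m.+1 w.
Proof.
move=> w0; rewrite /Phi /dPhi [Q m.+1]/= -/(Q m) powS//.
by rewrite /twlogder /logder !(hornerE, hornerXn)/=; field.
Qed.

Let Mom (m : nat) (a : R) : R := \int[mu]_(w in I) (dPhi m w * ratiopow a w).

Let cont_integrand (m : nat) (a : R) (w : R) : 0 < a -> I w ->
  {for w, continuous (fun w => dPhi m w * ratiopow a w)}.
Proof.
move=> a0 Iw; apply: cvgM.
  by apply: continuous_dPhi; exact: half_itv_gt0.
by apply: continuous_ratiopow => //; rewrite gt_eqF// half_itv_gt0.
Qed.

(** Integration by parts.  The ratio 1 / w - 1 is exp t, so its power a has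
    derivative a times itself with respect to t; this is where PhiS enters.
    The boundary term at w = 1 vanishes and the one at w = 1/2, that is t = 0,
    is a derivative of (F / 2) ^ (s + 1) at 0. *)
Let MomS (m : nat) (a : R) : 0 < a ->
  Mom m.+1 a + a * Mom m a = - (2^-1 `^ (s + 1) * twcoef (s + 1) m.+1).
Proof.
move=> a0; rewrite /Mom.
have ci k := fun x => @half_integrable _ (fun w => @cont_integrand k a w x).
rewrite -RintegralZl//; last exact: ci.
rewrite -RintegralD//; [|exact: ci|]; last first.
  apply: half_integrable => w Iw; apply: cvgM; first exact: cvg_cst.
  exact: cont_integrand.
transitivity (Phi m.+1 1 * ratiopow a 1 - Phi m.+1 2^-1 * ratiopow a 2^-1).
  apply: (@Rintegral_FTC2 _ (fun w => Phi m.+1 w * ratiopow a w)).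
  - by rewrite invf_lt1// ltr1n.
  - move=> w Iw; apply: cvgD; first exact: cont_integrand.
    by apply: cvgM; [exact: cvg_cst|exact: cont_integrand].
  - move=> w Iw; have w0 := half_itv_gt0 Iw; apply: cvgM.
      exact: continuous_derive (is_derive_Phi _ w0).
    by apply: continuous_ratiopow; rewrite ?gt_eqF.
  - move=> w; rewrite in_itv/= => /andP[h w1].
    have w0 : 0 < w by apply: lt_trans h; rewrite invr_gt0.
    have w01 : 0 < w < 1 by rewrite w0.
    have r0 : 0 < w^-1 - 1 by rewrite subr_gt0 invf_gt1.
    apply: (is_derive_eq (is_deriveM (is_derive_Phi m.+1 w0) (is_derive_ratiopow a w01))).
    rewrite -PhiS// /GRing.scale/= addrC; congr (_ + _); first by rewrite mulrC.
    have -> : ratiopow a w = (w^-1 - 1) * (w^-1 - 1) `^ (a - 1).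
      by rewrite mulr_powRB1 ?(ltW r0)// /ratiopow gtr0_norm.
    by field; rewrite gt_eqF.
rewrite {1}/ratiopow invr1 subrr normr0 powR0 ?gt_eqF// mulr0 sub0r.
rewrite /ratiopow invrK -[2 - 1]/(1 + 1 - 1) addrK normr1 powR1 mulr1.
by rewrite /Phi mulfV// pnatr_eq0.
Qed.

Definition powmoment (a : R) : R := \int[mu]_(w in I) (w `^ s * ratiopow a w).

Let Mom0 (a : R) : 0 < a -> Mom 0 a = (s + 1) * powmoment a.
Proof.
move=> a0; rewrite /Mom /powmoment -RintegralZl//; last first.
  apply: half_integrable => w Iw; apply: cvgM.
    exact: continuous_derive (is_derive1_powR s (half_itv_gt0 Iw)).
  by apply: continuous_ratiopow => //; rewrite gt_eqF// half_itv_gt0.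
by apply: eq_Rintegral => w _; rewrite /dPhi /Q /= derivC hornerC horner0; ring.
Qed.

(** K integrations by parts; the remaining integral is bounded uniformly in a
    because the ratio lies in [0, 1]. *)
Lemma powmoment_expansion (K : nat) : exists2 B : R, 0 <= B &
  forall a, 0 < a ->
  `|powmoment a - \sum_(1 <= m < K.+1)
     (2 `^ s)^-1 / 2 / (s + 1) * (-1) ^+ m * twcoef (s + 1) m / a ^+ m|
  <= B / a ^+ K.
Proof.
have ci m (w : R) : I w -> {for w, continuous (fun w => `|dPhi m w|)}.
  move=> Iw; apply: (@continuous_comp _ _ _ _ (fun y : R => `|y|)).
    by apply: continuous_dPhi; exact: half_itv_gt0.
  exact: norm_continuous.
have s1 : 0 < s + 1 by rewrite addr_gt0.
exists ((\int[mu]_(w in I) `|dPhi K w|) / (s + 1)).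
  by rewrite divr_ge0 ?(ltW s1)//; apply: Rintegral_ge0.
move=> a a0.
have E : (s + 1) * powmoment a = \sum_(1 <= m < K.+1)
    ((-1) ^+ m * (2^-1 `^ (s + 1) * twcoef (s + 1) m) / a ^+ m)
    + (-1) ^+ K / a ^+ K * Mom K a.
  rewrite -Mom0//; elim: (K) => [|k IH].
    by rewrite big_geq// add0r !expr0 divr1 mul1r.
  rewrite IH [in RHS]big_nat_recr// -[RHS]addrA; congr (_ + _).
  rewrite !exprS; have -> : Mom k.+1 a =
     - (2^-1 `^ (s + 1) * twcoef (s + 1) k.+1) - a * Mom k a.
    by rewrite -(MomS k a0) addrK.
  by field; rewrite expf_neq0 gt_eqF.
have -> : powmoment a - \sum_(1 <= m < K.+1)
     (2 `^ s)^-1 / 2 / (s + 1) * (-1) ^+ m * twcoef (s + 1) m / a ^+ m =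
   (-1) ^+ K / a ^+ K * Mom K a / (s + 1).
  have -> : powmoment a = ((s + 1) * powmoment a) / (s + 1) by rewrite mulrC mulKf// gt_eqF.
  rewrite E mulrDl addrAC mulr_suml -sumrB big1 ?add0r// => m _.
  rewrite powS ?invr_gt0// [2^-1 `^ s](_ : _ = (2 `^ s)^-1).
    by ring.
  by rewrite -powR_inv1// -powRrM mulN1r powRN.
rewrite !normrM normrX normrN1 expr1n mul1r !normfV normrX (gtr0_norm a0) (gtr0_norm s1).
rewrite [_^-1 * _]mulrC mulrAC ler_wpM2r ?invr_ge0 ?exprn_ge0 ?(ltW a0)//.
rewrite ler_wpM2r ?invr_ge0 ?(ltW s1)//.
apply: le_trans (le_normr_Rintegral _ (half_integrable _)) _ => //.
  by move=> w Iw; exact: cont_integrand.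
apply: le_Rintegral => //; [|exact/half_integrable/ci|].
  apply: half_integrable => w Iw.
  apply: (@continuous_comp _ _ _ _ (fun y : R => `|y|)); last exact: norm_continuous.
  exact: cont_integrand.
move=> w Iw; rewrite normrM ler_piMr//.
by have /andP[r0 r1] := ratiopow_itv a0 Iw; rewrite ger0_norm.
Qed.

Lemma powmoment0 : \int[mu]_(w in I) w `^ s = (1 - (2 `^ (s + 1))^-1) / (s + 1).
Proof.
have s1 : s + 1 != 0 by rewrite gt_eqF// addr_gt0.
transitivity ((s + 1)^-1 * 1 `^ (s + 1) - (s + 1)^-1 * 2^-1 `^ (s + 1)).
  apply: (@Rintegral_FTC2 _ (fun w => (s + 1)^-1 * w `^ (s + 1))).
  - by rewrite invf_lt1// ltr1n.
  - move=> w Iw; exact: continuous_derive (is_derive1_powR s (half_itv_gt0 Iw)).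
  - move=> w Iw; apply: cvgM; first exact: cvg_cst.
    exact: continuous_derive (is_derive1_powR _ (half_itv_gt0 Iw)).
  - move=> w; rewrite in_itv/= => /andP[h w1].
    have w0 : 0 < w by apply: lt_trans h; rewrite invr_gt0.
    apply: (is_derive_eq (is_deriveZ (s + 1)^-1 (is_derive1_powR (s + 1) w0))).
    by rewrite /GRing.scale/= mulKf// addrK.
rewrite powR1 -[2^-1 `^ (s + 1)](_ : (2 `^ (s + 1))^-1 = _); first by ring.
by rewrite -[2^-1]powR_inv1// -powRrM mulN1r powRN.
Qed.

(** The binomial series is integrated termwise, its remainder being bounded
    uniformly in w. *)
Lemma powmoment_binomial (n e : R) (M : nat) : 0 < n -> 0 <= e <= 1 ->
  `|\int[mu]_(w in I) (w `^ s * (1 + ratiopow n w) `^ e) -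
    (\int[mu]_(w in I) (w `^ s) +
     \sum_(N < M) gbin e N.+1 * powmoment (n * N.+1%:R))| <= 2 * `|gbin e M.+1|.
Proof.
move=> n0 e01.
have cs w : I w -> {for w, continuous (fun w : R => w `^ s)}.
  by move=> Iw; exact: continuous_derive (is_derive1_powR s (half_itv_gt0 Iw)).
have cr a w : 0 < a -> I w -> {for w, continuous (fun w : R => w `^ s * ratiopow a w)}.
  move=> a0 Iw; apply: cvgM; first exact: cs.
  by apply: continuous_ratiopow => //; rewrite gt_eqF// half_itv_gt0.
have cg a w : 0 < a -> I w ->
    {for w, continuous (fun w : R => w `^ s * (1 + ratiopow a w) `^ e)}.
  move=> a0 Iw; apply: cvgM; first exact: cs.
  apply: (@continuous_comp _ _ _ (fun w => 1 + ratiopow a w) (fun y : R => y `^ e)).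
    apply: cvgD; first exact: cvg_cst.
    by apply: continuous_ratiopow => //; rewrite gt_eqF// half_itv_gt0.
  have /andP[r0 _] := ratiopow_itv a0 Iw.
  have r1 : 0 < 1 + ratiopow a w by rewrite ltr_pwDl.
  exact: continuous_derive (is_derive1_powR e r1).
have nN (N : nat) : 0 < n * N.+1%:R by rewrite mulr_gt0.
pose T (k : nat) (w : R) := w `^ s + \sum_(N < k) gbin e N.+1 * (w `^ s * ratiopow (n * N.+1%:R) w).
have cT k w : I w -> {for w, continuous (T k)}.
  move=> Iw; elim: k => [|k IH].
    have -> : T 0%N = (fun w => w `^ s).
      by apply/funext => x; rewrite /T big_ord0 addr0.
    exact: cs.
  have -> : T k.+1 = (fun w => T k w + gbin e k.+1 * (w `^ s * ratiopow (n * k.+1%:R) w)).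
    by apply/funext => x; rewrite /T big_ord_recr/= addrA.
  apply: cvgD; first exact: IH.
  by apply: cvgM; [exact: cvg_cst|exact: cr].
have intT k : \int[mu]_(w in I) (w `^ s) +
    \sum_(N < k) gbin e N.+1 * powmoment (n * N.+1%:R) = \int[mu]_(w in I) T k w.
  elim: k => [|k IH].
    by rewrite big_ord0 addr0; apply: eq_Rintegral => w _; rewrite /T big_ord0 addr0.
  rewrite big_ord_recr/= addrA IH /powmoment -RintegralZl//; last first.
    by apply: half_integrable => w Iw; exact: cr.
  rewrite -RintegralD//.
  - by apply: eq_Rintegral => w _; rewrite /T big_ord_recr/= addrA.
  - by apply: half_integrable => w Iw; exact: cT.
  - apply: half_integrable => w Iw.
    by apply: cvgM; [exact: cvg_cst|exact: cr].
rewrite intT -RintegralB//; [|by apply: half_integrable => w Iw; exact: cg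
  |by apply: half_integrable => w Iw; exact: cT].
apply: half_integral_bound => //.
  by move=> w Iw; apply: cvgB; [exact: cg|exact: cT].
move=> w Iw.
have r01 := ratiopow_itv n0 Iw.
have [_ w1] := in_half Iw; have w0 := half_itv_gt0 Iw.
have -> : w `^ s * (1 + ratiopow n w) `^ e - T M w =
    w `^ s * ((1 + ratiopow n w) `^ e - \sum_(N < M.+1) gbin e N * ratiopow n w ^+ N).
  rewrite big_ord_recl/= gbin0 mul1r expr0 mulrBr; congr (_ - _).
  rewrite mulrDr mulr1 /T; congr (_ + _); rewrite big_distrr/=; apply: eq_bigr => N _.
  have -> : ratiopow (n * N.+1%:R) w = ratiopow n w ^+ N.+1.
    by rewrite /ratiopow powRrM powR_mulrn// powR_ge0.
  by rewrite /bump/= add1n mulrCA.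
rewrite normrM.
apply: (@le_trans _ _ (1 * `|(1 + ratiopow n w) `^ e - \sum_(N < M.+1) gbin e N * ratiopow n w ^+ N|)); last first.
  by rewrite mul1r; exact: binomial_remainder.
rewrite ler_wpM2r// ger0_norm ?powR_ge0//.
apply: (@le_trans _ _ (1 `^ s)); last by rewrite powR1.
by rewrite ge0_ler_powR ?nnegrE ?(ltW s0) ?(ltW w0).
Qed.

End laplace.
End half_interval.

(** * Summation of the expansions *)

Section expansion.
Context (R : realType).
Notation mu := (@lebesgue_measure R).
Notation I := (`[2^-1, 1]%classic : set R).

(** Collects the terms with a given total power p = m + k + 1 of 1 / n. *)
Lemma sum_triangle (g : nat -> nat -> R) (L : nat) :
  \sum_(1 <= m < L.+2) \sum_(k < L - m) g m k =
  \sum_(2 <= p < L.+1) \sum_(1 <= k < p) g (p - k)%N (k - 1)%N.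
Proof.
elim: L => [|L IH].
  by rewrite big_nat1 [RHS]big_geq// big_ord0.
rewrite big_nat_recr//= [X in _ + X](_ : _ = 0) ?addr0; last first.
  by rewrite (_ : (L.+1 - L.+2 = 0)%N) ?big_ord0//; apply/eqP; rewrite subn_eq0.
have -> : \sum_(1 <= m < L.+2) \sum_(k < L.+1 - m) g m k =
    \sum_(1 <= m < L.+2) \sum_(k < L - m) g m k + \sum_(1 <= m < L.+1) g m (L - m)%N.
  rewrite big_nat_recr//= subnn big_ord0 addr0.
  rewrite [in RHS]big_nat_recr//= (_ : (L - L.+1 = 0)%N); last first.
    by apply/eqP; rewrite subn_eq0.
  rewrite big_ord0 addr0 -big_split/=; apply: eq_big_nat => m /andP[_ mL].
  by rewrite subSn// big_ord_recr.
rewrite IH; case: L {IH} => [|L].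
  by rewrite !big_geq// addr0.
rewrite [in RHS]big_nat_recr//=; congr (_ + _).
rewrite [LHS]big_nat_rev/=; apply: eq_big_nat => k /andP[k1 kL].
by rewrite add1n subSS; congr (g _ _); case: k k1 kL => // k _ kL;
  rewrite subn1 /= subSS subKn// ltnW.
Qed.

Section coefficients.
Variable s : R.
Hypothesis s0 : 0 < s.

Definition expcoef (p : nat) : R :=
  (-1) ^+ p * \sum_(1 <= k < p) s ^+ k / (2 `^ s * (s + 1)) *
     altmzv R (p + 1 - k) (k - 1) * twcoef (s + 1) (p - k).

(** The coefficient of 1 / a ^ m in the expansion of powmoment s a. *)
Let c (m : nat) : R := (2 `^ s)^-1 / 2 / (s + 1) * (-1) ^+ m * twcoef (s + 1) m.

(** The terms of total degree at most L in 1 / n.  The zeta values are a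
    parameter z, so as to cover a single index N, the partial sums over N and
    their limit. *)
Let main (L : nat) (n : R) (z : nat -> nat -> R) : R :=
  \sum_(1 <= m < L.+2) \sum_(k < L - m)
    c m * (-1) ^+ k.+1 * s ^+ k.+1 / n ^+ (m + k.+1) * z m k.

Let mainE (L : nat) (n : R) : n != 0 ->
  main L n (fun m k => altmzv R m.+1 k) =
  \sum_(2 <= p < L.+1) (2^-1 * expcoef p) / n ^+ p.
Proof.
move=> n0.
rewrite /main (sum_triangle (fun m k => c m * (-1) ^+ k.+1 * s ^+ k.+1 / n ^+ (m + k.+1) * altmzv R m.+1 k)).
apply: eq_big_nat => p /andP[p2 pL].
rewrite /expcoef big_distrr /= big_distrr/= big_distrl/=.
apply: eq_big_nat => k /andP[k1 kp].
have e1 : ((k - 1).+1 = k)%N by rewrite subn1 prednK.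
have e2 : ((p - k).+1 = p + 1 - k)%N by rewrite addn1 subSn// ltnW.
rewrite e1 e2 subnK; last by rewrite ltnW.
have -> : (-1) ^+ p = (-1) ^+ (p - k) * (-1) ^+ k :> R.
  by rewrite -exprD subnK// ltnW.
rewrite /c; field.
by rewrite expf_neq0// powR_eq0 !gt_eqF// addr_gt0.
Qed.

(** For each m, the expansion of the binomial coefficient stops at the order
    L - m, just enough for the error to be of order L + 1 in 1 / n; the case
    m = L.+1 of the moment expansion then contributes to the error only, and
    guarantees that every error term carries at least two powers of 1 / N. *)
Let term_bound (L : nat) (B n : R) (i : nat) : 0 <= B -> 1 <= n -> s <= n ->
  (forall a, 0 < a -> `|powmoment s a - \sum_(1 <= m < L.+2) c m / a ^+ m|
     <= B / a ^+ L.+1) ->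
  `|gbin (s / n) i.+1 * powmoment s (n * i.+1%:R) -
    main L n (fun m k => (-1) ^+ i.+1 / i.+1%:R ^+ m.+1 * mzv_trunc R i k)| <=
  (s * B * (mzv_trunc R i 0 / i.+1%:R ^+ 2) + \sum_(1 <= m < L.+2)
    `|c m| * s ^+ (L - m).+1 * (mzv_trunc R i (L - m) / i.+1%:R ^+ 2)) / n ^+ L.+1.
Proof.
move=> B0 n1 sn HB.
set x : R := i.+1%:R.
have x1 : 1 <= x by rewrite -[leLHS]/(1%:R) ler_nat.
have x0 : 0 < x by apply: lt_le_trans x1.
have n0 : 0 < n by apply: lt_le_trans n1.
have nn : n != 0 by rewrite gt_eqF.
have xn : x != 0 by rewrite gt_eqF.
have e01 : 0 <= s / n <= 1 by rewrite divr_ge0 ?(ltW s0) ?(ltW n0)//= ler_pdivrMr ?mul1r.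
set e := s / n in e01 *; have /andP[e0 e1] := e01.
set g := gbin e i.+1.
have gx : `|g| <= e / x by exact: norm_gbin.
have nx0 : 0 < n * x by rewrite mulr_gt0.
have iV (a b : nat) (y : R) : 1 <= y -> (b <= a)%N -> (y ^+ a)^-1 <= (y ^+ b)^-1.
  move=> y1 ba; have y0 : 0 < y by apply: lt_le_trans y1.
  by rewrite lef_pV2 ?posrE ?exprn_gt0// ler_weXn2l.
have -> : g * powmoment s (n * x) -
    main L n (fun m k => (-1) ^+ i.+1 / x ^+ m.+1 * mzv_trunc R i k) =
  g * (powmoment s (n * x) - \sum_(1 <= m < L.+2) c m / (n * x) ^+ m) +
  \sum_(1 <= m < L.+2) c m / (n * x) ^+ m *
    ((-1) ^+ i * (e / x) * (altprod e i - \sum_(k < L - m) (- e) ^+ k * mzv_trunc R i k)).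
  rewrite mulrBr -addrA; congr (_ + _).
  rewrite mulr_sumr -sumrN -[in RHS]sumrN -big_split/=; apply: eq_bigr => m _.
  rewrite /g gbin_altprod -/x [in RHS]mulrBr.
  have -> : \sum_(k < L - m) c m * (-1) ^+ k.+1 * s ^+ k.+1 / n ^+ (m + k.+1) *
     ((-1) ^+ i.+1 / x ^+ m.+1 * mzv_trunc R i k) =
     c m / (n * x) ^+ m * ((-1) ^+ i * (e / x) * \sum_(k < L - m) (- e) ^+ k * mzv_trunc R i k).
    rewrite !big_distrr/=; apply: eq_bigr => k _.
    rewrite [(- e) ^+ _]exprNn /e !exprD !exprS !exprMn exprVn.
    by field; rewrite !expf_neq0 ?nn ?xn ?nat1r ?pnatr_eq0.
  by rewrite mulrBr; ring.
apply: le_trans (ler_normD _ _) _.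
rewrite mulrDl lerD//.
  rewrite normrM; apply: le_trans (ler_pM _ _ gx (HB _ nx0)) _ => //.
  rewrite mzv_trunc0 exprMn invfM mul1r.
  have -> : e / x * (B * ((n ^+ L.+1)^-1 / x ^+ L.+1)) =
     e * (B / n ^+ L.+1) * (x ^+ L.+2)^-1.
    by rewrite [x ^+ L.+2]exprS invfM; ring.
  have -> : s * B * (x ^+ 2)^-1 / n ^+ L.+1 = s * (B / n ^+ L.+1) * (x ^+ 2)^-1 by ring.
  have Bn : 0 <= B / n ^+ L.+1 by rewrite divr_ge0// exprn_ge0// ltW.
  apply: ler_pM; rewrite ?mulr_ge0 ?invr_ge0 ?exprn_ge0 ?(ltW x0) ?(ltW s0) ?(ltW n0)//.
    by rewrite ler_wpM2r// /e ler_pdivrMr// ler_peMr// ltW.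
  exact: iV.
rewrite mulr_suml; apply: le_trans (ler_norm_sum _ _ _) _.
rewrite big_seq [leRHS]big_seq; apply: ler_sum => m.
rewrite mem_index_iota => /andP[m1 mL]; move: (c m) => cm.
rewrite !normrM !normfV !normrX normrN1 expr1n mul1r normrM.
rewrite (gtr0_norm s0) (gtr0_norm x0) (gtr0_norm n0) -/e.
have bf := bonferroni i (L - m) e01.
set D := `|altprod e i - _| in bf *.
have -> : `|cm| * s ^+ (L - m).+1 * (mzv_trunc R i (L - m) / x ^+ 2) / n ^+ L.+1 =
  `|cm| * (s ^+ (L - m).+1 * mzv_trunc R i (L - m) * (n ^+ L.+1)^-1 * (x ^+ 2)^-1) by ring.
rewrite -mulrA ler_wpM2l//.
have z0 := mzv_trunc_ge0 R i (L - m).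
apply: (@le_trans _ _ (((n * x) ^+ m)^-1 * (e / x * (e ^+ (L - m) * mzv_trunc R i (L - m))))).
  rewrite ler_wpM2l ?invr_ge0 ?exprn_ge0 ?(ltW nx0)//.
  by rewrite ler_wpM2l// divr_ge0// ltW.
have -> : ((n * x) ^+ m)^-1 * (e / x * (e ^+ (L - m) * mzv_trunc R i (L - m))) =
   s ^+ (L - m).+1 * mzv_trunc R i (L - m) * (n ^+ (m + (L - m).+1))^-1 * (x ^+ m.+1)^-1.
  rewrite /e exprMn exprD !exprS exprMn exprVn.
  by field; rewrite !expf_neq0 ?nn ?xn ?nat1r ?pnatr_eq0.
have sz : 0 <= s ^+ (L - m).+1 * mzv_trunc R i (L - m).
  by rewrite mulr_ge0// exprn_ge0// ltW.
apply: ler_pM; rewrite ?mulr_ge0 ?invr_ge0 ?exprn_ge0 ?(ltW x0) ?(ltW n0) ?(ltW s0)//.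
  rewrite ler_wpM2l// iV// addnS ltnS.
  by rewrite -leq_subLR.
by rewrite iV.
Qed.

(** The bound of term_bound is summable over N uniformly in the number of
    terms; letting the latter tend to infinity removes the remainder of the
    binomial series and turns the partial sums into zeta values. *)
Lemma half_moment_expansion (L : nat) : exists C : R, forall n, 1 <= n -> s <= n ->
  `|\int[mu]_(w in I) (w `^ s * (1 + ratiopow n w) `^ (s / n)) -
    (1 - (2 `^ (s + 1))^-1) / (s + 1) -
    \sum_(2 <= p < L.+1) (2^-1 * expcoef p) / n ^+ p| <= C / n ^+ L.+1.
Proof.
have [B B0 HB] := powmoment_expansion s0 L.+1.
pose C := s * B * 2 + \sum_(1 <= m < L.+2) `|c m| * s ^+ (L - m).+1 * 2.
exists C => n n1 sn.
have n0 : 0 < n by apply: lt_le_trans n1.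
have e01 : 0 <= s / n <= 1 by rewrite divr_ge0 ?(ltW s0) ?(ltW n0)//= ler_pdivrMr ?mul1r.
set J := \int[mu]_(w in I) _ - _.
pose G (M : nat) := main L n (fun m k => altmzv_trunc R m.+1 k M).
have GE M : G M = \sum_(i < M) main L n
    (fun m k => (-1) ^+ i.+1 / i.+1%:R ^+ m.+1 * mzv_trunc R i k).
  rewrite /G /main exchange_big/=; apply: eq_bigr => m _.
  rewrite exchange_big/=; apply: eq_bigr => k _.
  by rewrite altmzv_truncE big_distrr.
have bound M : `|J - G M| <= 2 * (s / n / M.+1%:R) + C / n ^+ L.+1.
  have h1 := powmoment_binomial s0 M n0 e01.
  rewrite (powmoment0 s0) opprD addrA -/J in h1.
  have h2 := @norm_gbin R (s / n) M e01.
  have h3 : `|\sum_(i < M) gbin (s / n) i.+1 * powmoment s (n * i.+1%:R) - G M|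
      <= C / n ^+ L.+1.
    rewrite GE -sumrB; apply: le_trans (ler_norm_sum _ _ _) _.
    apply: le_trans; first by apply: ler_sum => i _; exact: (term_bound i B0 n1 sn HB).
    rewrite -mulr_suml ler_wpM2r ?invr_ge0 ?exprn_ge0 ?(ltW n0)//.
    rewrite big_split/= -mulr_sumr exchange_big/= /C lerD//.
      by rewrite ler_wpM2l ?mulr_ge0 ?(ltW s0)// sum_mzv_sqr.
    apply: ler_sum => m _; rewrite -mulr_sumr ler_wpM2l ?sum_mzv_sqr//.
    by rewrite mulr_ge0// exprn_ge0// ltW.
  have -> : J - G M = (J - \sum_(i < M) gbin (s / n) i.+1 * powmoment s (n * i.+1%:R))
     + (\sum_(i < M) gbin (s / n) i.+1 * powmoment s (n * i.+1%:R) - G M).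
    by rewrite addrA subrK.
  apply: le_trans (ler_normD _ _) _; rewrite lerD//.
  by apply: le_trans h1 _; rewrite ler_pM2l.
rewrite -mainE ?gt_eqF//.
have cG : G M @[M --> \oo] --> main L n (fun m k => altmzv R m.+1 k).
  have mainS z : main L n z = \sum_(m < L.+1) \sum_(k < L - m.+1)
      c m.+1 * (-1) ^+ k.+1 * s ^+ k.+1 / n ^+ (m.+1 + k.+1) * z m.+1 k.
    by rewrite /main big_add1 big_mkord.
  rewrite /G mainS; under eq_fun do rewrite mainS.
  apply: cvg_big => [|m _]; first exact: add_continuous.
  apply: cvg_big => [|k _]; first exact: add_continuous.
  by apply: cvgM; [exact: cvg_cst|exact: altmzv_cvg].
have c0 : 2 * (s / n / M.+1%:R) + C / n ^+ L.+1 @[M --> \oo] --> 2 * (s / n * 0) + C / n ^+ L.+1.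
  apply: cvgD; last exact: cvg_cst.
  apply: cvgM; first exact: cvg_cst.
  by apply: cvgM; [exact: cvg_cst|exact: cvg_harmonic].
have -> : C / n ^+ L.+1 = 2 * (s / n * 0) + C / n ^+ L.+1 by rewrite !mulr0 add0r.
apply: (@ler_cvg_to _ _ _ _ (fun M => `|J - G M|) _ _ _ _ c0).
  by apply: cvg_norm; apply: cvgB; [exact: cvg_cst|exact: cG].
by apply: nearW => M; exact: bound.
Qed.

End coefficients.
End expansion.

(** * The norm of a uniform point of the segment *)

Section reflection.
Context (R : realType).
Notation mu := (@lebesgue_measure R).

Lemma symmetric_integral (g : R -> R) : continuous g ->
  (forall u, g (1 - u) = g u) ->
  \int[mu]_(u in `[0, 1]%classic) g u = 2 * \int[mu]_(u in `[2^-1, 1]%classic) g u.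
Proof.
move=> cg sg.
have h0 : 0 <= 2^-1 :> R by rewrite invr_ge0.
have h1 : 2^-1 <= 1 :> R by rewrite invf_le1// ler1n.
have ig a b : mu.-integrable `[a, b]%classic (EFin \o g).
  apply: continuous_compact_integrable; first exact: segment_compact.
  by apply: continuous_in_subspaceT => x _; exact: cg.
have half : unstable.onem 2^-1 = 2^-1 :> R by rewrite /unstable.onem; field.
have E := @Rintegral_itvB R g (BLeft 0) (BRight 1) 2^-1 (ig 0 1).
rewrite !bnd_simp in E; have {}E := E h0 h1.
rewrite Rintegral_itv_obnd_cbnd in E; last first.
  by apply: integrableS (ig 2^-1 1) => //; apply: subset_itvr; rewrite bnd_simp.
move/eqP: E; rewrite subr_eq => /eqP ->.
rewrite (@Rintegration_by_substitution_onem R g 2^-1) ?h0//; last first.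
  by apply: continuous_in_subspaceT => x _; exact: cg.
rewrite half mulr_natl mulr2n; congr (_ + _).
by apply: eq_Rintegral => u _; exact: sg.
Qed.

Lemma cvg_powR2_inv (c : R) : 2 `^ (c / n) @[n --> +oo] --> (1 : R).
Proof.
have -> : (fun n : R => 2 `^ (c / n)) = expR \o (fun n => c / n * ln 2).
  by apply/funext => n; rewrite /= /powR gt_eqF.
have h : c / n * ln 2 @[n --> +oo] --> c * 0 * ln 2.
  apply: cvgM; last exact: cvg_cst.
  apply: cvgM; first exact: cvg_cst.
  apply/(@gtr0_cvgV0 _ _ _ _ id); last exact: cvg_id.
  by near=> n; near: n; exact: nbhs_pinfty_gt.
rewrite mulr0 mul0r in h; rewrite -[X in _ --> X]expR0.
by apply: continuous_cvg h; exact: continuous_expR.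
Unshelve. all: by end_near. Qed.

End reflection.

Section uniform_norm.
Context (R : realType).
Notation mu := (@lebesgue_measure R).

Definition pnorm (n u : R) : R := (u `^ n + (1 - u) `^ n) `^ n^-1.

Lemma pnorm_ge0 (n u : R) : 0 <= pnorm n u.
Proof. exact: powR_ge0. Qed.

Lemma max_ge0 (u : R) : 0 <= Num.max u (1 - u).
Proof. by rewrite le_max; case: leP => //= u0; rewrite subr_ge0 (le_trans (ltW u0)). Qed.

Lemma max_le_pnorm (n u : R) : 0 < n -> 0 <= u <= 1 ->
  Num.max u (1 - u) <= pnorm n u.
Proof.
move=> n0 /andP[u0 u1].
have root x : 0 <= x -> x = (x `^ n) `^ n^-1.
  by move=> x0; rewrite -powRrM mulfV ?gt_eqF// powRr1.
have v0 : 0 <= 1 - u by rewrite subr_ge0.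
rewrite ge_max; apply/andP; split.
  rewrite [leLHS](root _ u0) ge0_ler_powR ?nnegrE ?invr_ge0 ?(ltW n0) ?addr_ge0 ?powR_ge0//.
  by rewrite lerDl powR_ge0.
rewrite [leLHS](root _ v0) ge0_ler_powR ?nnegrE ?invr_ge0 ?(ltW n0) ?addr_ge0 ?powR_ge0//.
by rewrite lerDr powR_ge0.
Qed.

Lemma pnorm_le_max (n u : R) : 0 < n -> 0 <= u <= 1 ->
  pnorm n u <= 2 `^ n^-1 * Num.max u (1 - u).
Proof.
move=> n0 /andP[u0 u1].
have m0 := max_ge0 u.
have root x : 0 <= x -> x = (x `^ n) `^ n^-1.
  by move=> x0; rewrite -powRrM mulfV ?gt_eqF// powRr1.
have v0 : 0 <= 1 - u by rewrite subr_ge0.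
have um : u <= Num.max u (1 - u) by rewrite le_max lexx.
have vm : 1 - u <= Num.max u (1 - u) by rewrite le_max lexx orbT.
move: (Num.max u (1 - u)) m0 um vm => m m0 um vm.
have -> : 2 `^ n^-1 * m = (2 * m `^ n) `^ n^-1.
  by rewrite (powRM n^-1 (ler0n R 2) (powR_ge0 _ _)) -root.
apply: ge0_ler_powR; rewrite ?nnegrE ?invr_ge0 ?(ltW n0) ?addr_ge0 ?mulr_ge0 ?powR_ge0//.
by rewrite mulr_natl mulr2n lerD// ge0_ler_powR ?nnegrE ?(ltW n0).
Qed.

Lemma pnorm_ratiopow (n s w : R) : 0 < n -> 0 < w ->
  ((`|w| `^ n + `|1 - w| `^ n) `^ n^-1) `^ s =
  w `^ s * (1 + ratiopow n w) `^ (s / n).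
Proof.
move=> n0 w0.
have rp0 : 0 <= ratiopow n w by exact: powR_ge0.
have -> : `|1 - w| `^ n = w `^ n * ratiopow n w.
  have -> : 1 - w = w * (w^-1 - 1) by rewrite mulrBr mulr1 mulfV ?gt_eqF.
  by rewrite normrM (gtr0_norm w0) (powRM n (ltW w0) (normr_ge0 _)).
have -> : `|w| `^ n + w `^ n * ratiopow n w = w `^ n * (1 + ratiopow n w).
  by rewrite (gtr0_norm w0) mulrDr mulr1.
rewrite (powRM n^-1 (powR_ge0 _ _)) ?addr_ge0//.
rewrite -[(w `^ n) `^ _]powRrM mulfV ?gt_eqF// powRr1 ?(ltW w0)//.
by rewrite (powRM s (ltW w0) (powR_ge0 _ _)) -powRrM [_^-1 * _]mulrC.
Qed.

(** Absolute values make the integrand continuous on the whole line, as the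
    reflection u |-> 1 - u and the restriction to [1/2, 1] require. *)
Lemma pnorm_integral (n s : R) : 0 < n ->
  \int[mu]_(u in `[0, 1]%classic) (pnorm n u `^ s) =
  2 * \int[mu]_(w in `[2^-1, 1]%classic) (w `^ s * (1 + ratiopow n w) `^ (s / n)).
Proof.
move=> n0.
pose g (u : R) := ((`|u| `^ n + `|1 - u| `^ n) `^ n^-1) `^ s.
have cg : continuous g.
  move=> u.
  have pw (a x : R) : 0 < x -> {for x, continuous (fun y : R => y `^ a)}.
    move=> x0; apply: differentiable_continuous; apply/derivable1_diffP.
    by apply: derivable_powR; rewrite in_itv/= andbT.
  have s0 : 0 < `|u| `^ n + `|1 - u| `^ n.
    have [->|u0] := eqVneq u 0.
      by rewrite normr0 powR0 ?gt_eqF// add0r subr0 normr1 powR1.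
    by rewrite ltr_wpDr ?powR_ge0// powR_gt0// normr_gt0.
  apply: (@continuous_comp _ _ _ (fun u : R => (`|u| `^ n + `|1 - u| `^ n) `^ n^-1) (fun y => y `^ s)).
    apply: (@continuous_comp _ _ _ (fun u : R => `|u| `^ n + `|1 - u| `^ n) (fun y => y `^ n^-1)).
      apply: cvgD; first exact: continuous_norm_powR.
      apply: (@continuous_comp _ _ _ (fun u : R => 1 - u) (fun y => `|y| `^ n)).
        by apply: cvgB; [exact: cvg_cst|exact: cvg_id].
      exact: continuous_norm_powR.
    exact: pw.
  by apply: pw; exact: powR_gt0.
transitivity (\int[mu]_(u in `[0, 1]%classic) g u).
  apply: eq_Rintegral => u /set_mem; rewrite /= in_itv/= => /andP[u0 u1].
  by rewrite /pnorm /g !ger0_norm// subr_ge0.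
have sg u : g (1 - u) = g u.
  by rewrite /g opprB addrCA subrr addr0 addrC.
rewrite (symmetric_integral cg sg).
congr (_ * _); apply: eq_Rintegral => w /set_mem Iw.
by rewrite /g pnorm_ratiopow// (half_itv_gt0 Iw).
Qed.

Lemma measurable_pnorm (n : R) : measurable_fun [set: R] (pnorm n).
Proof.
apply: (measurableT_comp (f := fun x : R => x `^ n^-1)) => //.
apply: measurable_funD; first exact: (measurableT_comp (f := fun x : R => x `^ n)).
apply: (measurableT_comp (f := fun x : R => x `^ n)) => //.
exact: measurable_funB.
Qed.

Context (d : measure_display) (T : measurableType d)
  (P : probability T R) (U : {RV P >-> R}).
Hypothesis uniformU : forall A : set R, measurable A ->
  distribution P U A = uniform_prob (@ltr01 R) A.

(** The law of U lives on a sigma-algebra of R that carries a different display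
    from the one used by Lebesgue measure, although the measurable sets are the
    same; U is repackaged as a measurable function into the latter space. *)
Lemma expectation_uniform (f : R -> R) : measurable_fun [set: R] f ->
  (forall u, 0 <= f u) ->
  ('E_P[(fun w => f (U w))] = \int[mu]_(u in `[0%R, 1%R]%classic) (f u)%:E)%E.
Proof.
move=> mf f0; rewrite unlock.
have mf' : measurable_fun [set: R] (EFin \o f) by exact/measurable_EFinP.
have mU : measurable_fun (U := measurableTypeR R) [set: T] U.
  by move=> mT A mA; exact: (@measurable_funP _ _ _ _ _ U).
pose mixU := isMeasurableFun.Build _ _ T (measurableTypeR R) U mU.
pose U' : {RV P >-> measurableTypeR R} := HB.pack (U : T -> measurableTypeR R) mixU.
have -> : (\int[P]_w (f (U w))%:E = \int[distribution P U']_u (f u)%:E)%E.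
  by rewrite (ge0_integral_distribution U' mf')// => y; rewrite lee_fin.
have -> : (\int[distribution P U']_u (f u)%:E =
    \int[uniform_prob (@ltr01 R)]_u (f u)%:E)%E.
  by apply: eq_measure_integral => A mA _; exact: uniformU.
rewrite integral_uniform//.
by rewrite subr0 invr1 mul1e.
Qed.

Lemma fine_expectation_pnorm (n s : R) : 0 < n ->
  fine 'E_P[(fun w => Z U n w `^ s)%R]%E =
  2 * \int[mu]_(w in `[2^-1, 1]%classic) (w `^ s * (1 + ratiopow n w) `^ (s / n)).
Proof.
move=> n0; rewrite -pnorm_integral// -[in LHS]/(fun w => pnorm n (U w) `^ s).
rewrite (@expectation_uniform (fun u => pnorm n u `^ s))//; last first.
  by move=> u; exact: powR_ge0.
apply: (measurableT_comp (f := fun x : R => x `^ s)) => //.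
exact: measurable_pnorm.
Qed.

Let uniform_itv01 : P (U @^-1` (~` `[0, 1]%classic)) = 0%E.
Proof.
transitivity (uniform_prob (@ltr01 R) (~` `[0, 1]%classic)).
  by rewrite -uniformU//; apply: measurableC.
by rewrite /uniform_prob integral_uniform_pdf setICl integral_set0.
Qed.

Let le_uniform_prob (A B : set R) : measurable A -> measurable B ->
  (forall u, 0 <= u <= 1 -> A u -> B u) ->
  (P (U @^-1` A) <= P (U @^-1` B))%E.
Proof.
move=> mA mB AB.
have mU (C : set R) : measurable C -> measurable (U @^-1` C).
  by move=> mC; rewrite -[X in measurable X]setTI; exact: measurable_funP.
have mI : measurable (~` `[0, 1]%classic : set R) by exact: measurableC.
rewrite -(measureU0 (mU _ mB) (mU _ mI) uniform_itv01).
apply: le_measure; rewrite ?inE; [exact: mU|exact: measurableU (mU _ mB) (mU _ mI)|].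
move=> w Aw; have [U01|U01] := pselect ((`[0, 1]%classic : set R) (U w)); last by right.
by left; apply: AB => //; move: U01; rewrite /= in_itv.
Qed.

(** Sandwich: the distribution function of Z_n lies between those of
    2 ^ (1/n) Z_oo and of Z_oo, and the former is that of Z_oo at a point which
    tends to x. *)
Lemma cvg_distribution_pnorm :
  cvg_in_distribution (+oo : set_system R) (Z_RV U) (Zoo_RV U).
Proof.
move=> x cx.
have mle (f : R -> R) (y : R) : measurable_fun [set: R] f -> measurable [set u | f u <= y].
  move=> mf; rewrite (_ : [set u | _] = setT `&` f @^-1` `]-oo, y]%classic).
    exact: mf.
  by rewrite setTI; apply/seteqP; split => u /=; rewrite in_itv.
have mmax : measurable_fun [set: R] (fun u : R => Num.max u (1 - u)).
  by apply: measurable_maxr => //; exact: measurable_funB.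
have EZ n y : cdf (Z_RV U n) y = P (U @^-1` [set u | pnorm n u <= y]).
  by [].
have EZoo y : cdf (Zoo_RV U) y = P (U @^-1` [set u | Num.max u (1 - u) <= y]).
  by [].
apply: (@squeeze_cvge _ _ _ _ (fun n => cdf (Zoo_RV U) (x / 2 `^ (1 / n))) _
  (fun=> cdf (Zoo_RV U) x)); last exact: cvg_cst.
  near=> n.
  have n0 : 0 < n by near: n; exact: nbhs_pinfty_gt.
  rewrite EZ !EZoo; apply/andP; split; (apply: le_uniform_prob;
    [by apply: mle => //; exact: measurable_pnorm|by apply: mle => //; exact: measurable_pnorm|]).
  - move=> u u01 /=; rewrite ler_pdivlMr ?powR_gt0// => h.
    by apply: le_trans (pnorm_le_max n0 u01) _; rewrite mulrC -div1r.
  - by move=> u u01 /=; apply: le_trans; exact: max_le_pnorm.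
apply: (@cvg_comp _ _ _ (fun n => x / 2 `^ (1 / n)) (cdf (Zoo_RV U)) _ (nbhs x)); last exact: cx.
have h : x / 2 `^ (1 / n) @[n --> +oo] --> x * 1^-1.
  apply: cvgM; first exact: cvg_cst.
  by apply: cvgV; [rewrite oner_eq0|exact: cvg_powR2_inv].
by rewrite invr1 mulr1 in h.
Unshelve. all: by end_near. Qed.

Lemma cvg_moment_pnorm (s : nat) :
  'E_P[(fun w => Z U n w ^+ s)%R]%E @[n --> +oo] -->
  'E_P[(fun w => Zoo U w ^+ s)%R]%E.
Proof.
have mmax : measurable_fun [set: R] (fun u : R => Num.max u (1 - u)).
  by apply: measurable_maxr => //; exact: measurable_funB.
have EZ n : ('E_P[(fun w => Z U n w ^+ s)%R] =
    \int[mu]_(u in `[0%R, 1%R]%classic) (pnorm n u ^+ s)%:E)%E.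
  apply: (@expectation_uniform (fun u => pnorm n u ^+ s)).
    by apply: measurable_funX; exact: measurable_pnorm.
  by move=> u; rewrite exprn_ge0// pnorm_ge0.
have EZoo : ('E_P[(fun w => Zoo U w ^+ s)%R] =
    \int[mu]_(u in `[0%R, 1%R]%classic) (Num.max u (1 - u) ^+ s)%:E)%E.
  apply: (@expectation_uniform (fun u => Num.max u (1 - u) ^+ s)).
    exact: measurable_funX.
  by move=> u; rewrite exprn_ge0// max_ge0.
rewrite EZoo; under eq_fun do rewrite EZ.
set c := (\int[mu]_(u in _) (Num.max u _ ^+ s)%:E)%E.
have m01 (f : R -> R) : measurable_fun [set: R] f ->
   measurable_fun (`[0, 1]%classic : set R) (fun u => (f u)%:E).
  by move=> mf; apply/measurable_EFinP; exact: measurable_funTS.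
have c_ge0 : (0 <= c)%E.
  by apply: integral_ge0 => u _; rewrite lee_fin exprn_ge0// max_ge0.
have c_le1 : (c <= 1)%E.
  apply: (@le_trans _ _ (\int[mu]_(u in `[0%R, 1%R]%classic) 1%:E)%E).
    apply: ge0_le_integral => //.
    - by move=> u _; rewrite lee_fin exprn_ge0// max_ge0.
    - by apply: m01; exact: measurable_funX.
    - move=> u; rewrite /= in_itv/= => /andP[u0 u1]; rewrite lee_fin exprn_ile1 ?max_ge0//.
      by rewrite ge_max u1 lerBlDr lerDl.
  have mu1 : (mu `[0%R, 1%R]%classic <= 1)%E.
    by rewrite lebesgue_measure_itv/= lte_fin ltr01 oppr0 adde0.
  by rewrite integral_cst// mul1e; exact: mu1.
have cfin : c \is a fin_num.
  by rewrite ge0_fin_numE// (le_lt_trans c_le1)// ltry.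
apply: (@squeeze_cvge _ _ _ _ (fun=> c) _ (fun n => ((2 `^ (1 / n)) ^+ s * fine c)%:E)).
- near=> n.
  have n0 : 0 < n by near: n; exact: nbhs_pinfty_gt.
  apply/andP; split.
    apply: ge0_le_integral => //.
    + by move=> u _; rewrite lee_fin exprn_ge0// max_ge0.
    + by apply: m01; exact: measurable_funX.
    + by apply: m01; apply: measurable_funX; exact: measurable_pnorm.
    + move=> u; rewrite /= in_itv/= => u01; rewrite lee_fin.
      by rewrite lerXn2r ?nnegrE ?max_ge0 ?pnorm_ge0// max_le_pnorm.
  rewrite EFinM fineK// /c -ge0_integralZl_EFin//; last 2 first.
  - by move=> u _; rewrite lee_fin exprn_ge0// max_ge0.
  - by apply: m01; exact: measurable_funX.
  apply: ge0_le_integral => //.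
  + by move=> u _; rewrite lee_fin exprn_ge0// pnorm_ge0.
  + by apply: m01; apply: measurable_funX; exact: measurable_pnorm.
  + apply: (m01 (fun u => (2 `^ (1 / n)) ^+ s * Num.max u (1 - u) ^+ s)).
    by apply: measurable_funM => //; exact: measurable_funX.
  + move=> u; rewrite /= in_itv/= => u01; rewrite -EFinM lee_fin -exprMn.
    rewrite lerXn2r ?nnegrE ?mulr_ge0 ?powR_ge0 ?max_ge0 ?pnorm_ge0//.
    by rewrite div1r; exact: pnorm_le_max.
- exact: cvg_cst.
- have -> : (fun n : R => ((2 `^ (1 / n)) ^+ s * fine c)%:E) =
      (fun n : R => (2 `^ (s%:R / n) * fine c)%:E).
    apply/funext => n; rewrite -powR_mulrn ?powR_ge0// -powRrM.
    by rewrite div1r [n^-1 * _]mulrC.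
  rewrite -[X in _ --> X](fineK cfin) -[X in _ --> X%:E]mul1r.
  apply: cvg_EFin; first by near=> n.
  by apply: cvgM; [exact: cvg_powR2_inv|exact: cvg_cst].
Unshelve. all: by end_near. Qed.

Lemma asymptotic_pnorm (s : R) : 0 < s ->
  asymptotic_expansion 2
    (fun n : R => fine ('E_P[(fun w => Z U n w `^ s)%R])%E
                  - 2 * (1 - 1 / 2 `^ (s + 1)) / (s + 1))
    (expcoef s).
Proof.
move=> s0 N; have [C HC] := half_moment_expansion s0 N.
apply/cvgr0Pnorm_le => e e0; near=> n.
have n0 : 0 < n by near: n; exact: nbhs_pinfty_gt.
have n1 : 1 <= n by near: n; apply: nbhs_pinfty_ge; exact: num_real.
have ns : s <= n by near: n; apply: nbhs_pinfty_ge; exact: num_real.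
have nC : 2 * C / e <= n by near: n; apply: nbhs_pinfty_ge; exact: num_real.
rewrite fine_expectation_pnorm//.
set J := \int[mu]_(w in _) _.
have -> : 2 * J - 2 * (1 - 1 / 2 `^ (s + 1)) / (s + 1) -
    \sum_(2 <= p < N.+1) expcoef s p / n ^+ p =
  2 * (J - (1 - (2 `^ (s + 1))^-1) / (s + 1) -
     \sum_(2 <= p < N.+1) (2^-1 * expcoef s p) / n ^+ p).
  rewrite [in RHS]mulrBr; congr (_ - _); first by rewrite div1r -[in LHS]mulrA -mulrBr.
  rewrite big_distrr/=; apply: eq_bigr => p _.
  by rewrite !mulrA mulfV ?mul1r// pnatr_eq0.
have := HC n n1 ns; rewrite -/J; set D := J - _ - _ => HD.
rewrite !normrM normrX (gtr0_norm n0) (ger0_norm (ler0n R 2)).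
apply: (@le_trans _ _ (n ^+ N * (2 * (C / n ^+ N.+1)))).
  by rewrite ler_wpM2l ?exprn_ge0 ?(ltW n0)// ler_wpM2l.
have -> : n ^+ N * (2 * (C / n ^+ N.+1)) = 2 * C / n.
  by rewrite exprS; field; rewrite expf_neq0 gt_eqF.
by rewrite ler_pdivrMr// [e * n]mulrC -ler_pdivrMr.
Unshelve. all: by end_near. Qed.

End uniform_norm.

Lemma expcoef_nat (R : realType) (s p : nat) :
  expcoef (s%:R : R) p = (-1) ^+ p *
    \sum_(1 <= k < p) s%:R ^+ k / s.+1%:R *
      \sum_(1 <= j < s.+2)
        gamma_coef R s j * (-1) ^+ (j - 1) *
        euler_poly (p - k + j - 1) 0 *
        altmzv R (p + 1 - k) (k - 1).
Proof.
rewrite /expcoef; congr (_ * _); apply: eq_big_nat => k /andP[_ kp].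
have t0 : 2 ^+ s != 0 :> R by rewrite expf_neq0.
have -> : twcoef (s%:R + 1 : R) (p - k) = 2 ^+ s * (twcoef s.+1%:R (p - k) / 2 ^+ s).
  by rewrite natr1 mulrC divfK.
rewrite twcoef_stirling1 natr1 powR_mulrn// big_add1/= big_mkord.
rewrite -mulr_suml mulrACA.
have -> : \sum_(i < s.+1) gamma_coef R s i.+1 * (-1) ^+ (i.+1 - 1) *
      euler_poly (p - k + i.+1 - 1) 0 =
    \sum_(j < s.+1) (stirling1 s.+1 j.+1)%:R / s`!%:R * eulerp R (p - k + j).
  apply: eq_bigr => j _; rewrite addnS !subn1/= euler_poly0 /gamma_coef subn1/=.
  congr (_ * _); have : (-1) ^+ j * (-1) ^+ j = 1 :> R.
    by rewrite -exprMn mulrNN mulr1 expr1n.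
  by move=> uu; rewrite -[RHS]mul1r -[X in X * (_ / _)]uu; ring.
set S := \sum_(j < s.+1) _.
by field; rewrite t0 nat1r pnatr_eq0.
Qed.

Theorem theorem3 (R : realType) (d : measure_display) (T : measurableType d)
    (P : probability T R) (U : {RV P >-> R})
    (uniformU : forall A : set R, measurable A ->
       distribution P U A = uniform_prob (@ltr01 R) A) :
  [/\
    cvg_in_distribution (+oo : set_system R) (Z_RV U) (Zoo_RV U),
    forall s : nat,
      'E_P[(fun w => Z U n w ^+ s)%R]%E @[n --> +oo] -->
      'E_P[(fun w => Zoo U w ^+ s)%R]%E,
    forall s : nat, (1 <= s)%N ->
      asymptotic_expansion 2
        (fun n : R => fine ('E_P[(fun w => Z U n w ^+ s)%R])%E
                      - 2 * (1 - 1 / 2 ^+ s.+1) / s.+1%:R)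
        (fun p : nat => (-1) ^+ p *
           \sum_(1 <= k < p) s%:R ^+ k / s.+1%:R *
             \sum_(1 <= j < s.+2)
               gamma_coef R s j * (-1) ^+ (j - 1) *
               euler_poly (p - k + j - 1) 0 *
               altmzv R (p + 1 - k) (k - 1)) /\
      (forall j : nat, (1 <= j <= s.+1)%N ->
         gamma_coef R s j = (-1) ^+ (j - 1) * mzv_trunc R s (j - 1))
  & forall s : R, 0 < s ->
      asymptotic_expansion 2
        (fun n : R => fine ('E_P[(fun w => Z U n w `^ s)%R])%E
                      - 2 * (1 - 1 / 2 `^ (s + 1)) / (s + 1))
        (fun p : nat => (-1) ^+ p *
           \sum_(1 <= k < p) s ^+ k / (2 `^ s * (s + 1)) *
             altmzv R (p + 1 - k) (k - 1) *
             \sum_(1 <= l < (p - k).+1)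
               falling (s + 1) l *
               bell (p - k) l (fun i : nat => euler_poly i 0))].
Proof.
split.
- exact: cvg_distribution_pnorm.
- exact: cvg_moment_pnorm.
- move=> s s1; split; last by move=> j /andP[j1 _]; exact: gamma_coefE.
  have s0 : 0 < s%:R :> R by rewrite ltr0n.
  have E1 : (fun n : R => fine ('E_P[(fun w => Z U n w ^+ s)%R])%E
       - 2 * (1 - 1 / 2 ^+ s.+1) / s.+1%:R) =
     (fun n : R => fine ('E_P[(fun w => Z U n w `^ s%:R)%R])%E
       - 2 * (1 - 1 / 2 `^ (s%:R + 1)) / (s%:R + 1)).
    apply/funext => n; rewrite natr1 powR_mulrn//; congr (fine _ - _).
    by congr ('E_P[_])%E; apply/funext => w; rewrite powR_mulrn// powR_ge0.
  rewrite E1; have := asymptotic_pnorm uniformU s0.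
  congr (asymptotic_expansion _ _ _); apply/funext => p.
  by rewrite expcoef_nat.
- move=> s s0; have := asymptotic_pnorm uniformU s0.
  congr (asymptotic_expansion _ _ _); apply/funext => p.
  rewrite /expcoef; congr (_ * _); apply: eq_big_nat => k /andP[_ kp].
  by rewrite twcoef_bell// subn_gt0.
Qed.
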